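(* Let $M$ be a real constant and let $g=g_1+\overline{g_2}$ be a complex-valued harmonic function in the unit disk $U$, where $g_1,g_2$ are analytic in $U$ and $g_2(0)=0$, with $g(0)=\lambda_g(0)-1=0$ and $|g_1(z)|+|g_2(z)|\le M$ for all $z\in U$. Put $$r_3'=\frac{1}{1+2\bigl(M-\frac1M\bigr)+\sqrt{M-\frac1M+4\bigl(M-\frac1M\bigr)^2}},$$ and $$\sigma_3'=\begin{cases} r_3'^3-\Bigl(M-\dfrac1M\Bigr)\cdot\dfrac{r_3'^4}{1-r_3'}, & M>1,\\ 1, & M=1.\end{cases}$$ Then $F(z)=|z|^2g(z)$ is univalent in the disk $U_{r_3'}$, and $F(U_{r_3'})$ contains the schlicht disk $U_{\sigma_3'}$. The result is sharp for $M=1$, i.e. for $M=1$ the radii $r_3'=\sigma_3'=1$ are best possible (neither can be replaced by a larger constant valid for all such $g$).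
   Context: $U=\{z\in\mathbb{C}:|z|<1\}$ is the open unit disk and, for $r>0$, $U_r=\{z\in\mathbb{C}:|z|<r\}$. Univalent means injective. For a differentiable complex-valued function $f$, with $z=x+iy$, put $f_z=\frac12(f_x-if_y)$, $f_{\overline z}=\frac12(f_x+if_y)$, and $\lambda_f(z)=\bigl||f_z(z)|-|f_{\overline z}(z)|\bigr|$. (The hypotheses force $M\ge1$.) *)

(* Defs.v *)
(* Stdlib reals with Coquelicot; complex numbers are Coquelicot's C. *)
From Stdlib Require Import Reals.
From Coquelicot Require Import Coquelicot.
Open Scope R_scope.

Definition disk (r : R) (z : C) : Prop := Cmod z < r.

Definition analytic_on (D : C -> Prop) (f : C -> C) : Prop :=
  forall z : C, D z -> @ex_derive C_AbsRing C_NormedModule f z.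

(* [ex_diff_n u 2 x y] says that u, its partial derivatives and its second
   partial derivatives exist and are continuous at (x, y); so, required at all
   points of an open set D, it says that u is of class C^2 on D. *)
Definition real_harmonic_on (D : C -> Prop) (u : R -> R -> R) : Prop :=
  forall x y : R, D (x, y) ->
    ex_diff_n u 2 x y /\
    partial_derive 2 0 u x y + partial_derive 0 2 u x y = 0.

Definition harmonic_on (D : C -> Prop) (f : C -> C) : Prop :=
  real_harmonic_on D (fun x y => Re (f (x, y))) /\
  real_harmonic_on D (fun x y => Im (f (x, y))).

Definition d_x (f : C -> C) (z : C) : C :=
  (Derive (fun t => Re (f (t, Im z))) (Re z),
   Derive (fun t => Im (f (t, Im z))) (Re z)).

Definition d_y (f : C -> C) (z : C) : C :=
  (Derive (fun t => Re (f (Re z, t))) (Im z),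
   Derive (fun t => Im (f (Re z, t))) (Im z)).

Definition d_z (f : C -> C) (z : C) : C :=
  (/ 2 * (d_x f z - Ci * d_y f z))%C.

Definition d_zbar (f : C -> C) (z : C) : C :=
  (/ 2 * (d_x f z + Ci * d_y f z))%C.

Definition lambda (f : C -> C) (z : C) : R :=
  Rabs (Cmod (d_z f z) - Cmod (d_zbar f z)).

(* Functions on the unit disk are represented by total functions on C; all
   conditions below constrain only the values on the unit disk. *)
Definition admissible (M : R) (g : C -> C) : Prop :=
  harmonic_on (disk 1) g /\
  exists g1 g2 : C -> C,
    analytic_on (disk 1) g1 /\
    analytic_on (disk 1) g2 /\
    (forall z : C, disk 1 z -> g z = (g1 z + Cconj (g2 z))%C) /\
    g2 0 = 0 /\
    g 0 = 0 /\
    lambda g 0 - 1 = 0 /\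
    (forall z : C, disk 1 z -> Cmod (g1 z) + Cmod (g2 z) <= M).

Definition F (g : C -> C) (z : C) : C := (RtoC (Cmod z ^ 2) * g z)%C.

(* Univalence on D of a function whose domain of definition is Om. The
   inclusion of D in Om has to be stated because functions are total: outside
   Om their values are arbitrary. *)
Definition univalent_on (Om : C -> Prop) (f : C -> C) (D : C -> Prop) : Prop :=
  (forall z : C, D z -> Om z) /\
  (forall z w : C, D z -> D w -> f z = f w -> z = w).

Definition image_contains (f : C -> C) (D E : C -> Prop) : Prop :=
  forall w : C, E w -> exists z : C, D z /\ f z = w.

Definition r3 (M : R) : R :=
  1 / (1 + 2 * (M - 1 / M)
       + sqrt ((M - 1 / M) + 4 * (M - 1 / M) ^ 2)).

(* Admissibility forces 1 <= M, so the second branch is the case M = 1. *)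
Definition sigma3 (M : R) : R :=
  if Rlt_dec 1 M
  then r3 M ^ 3 - (M - 1 / M) * (r3 M ^ 4 / (1 - r3 M))
  else 1.

(* Main.v *)
Require Import Defs.
From Stdlib Require Import Reals Lra Classical ClassicalEpsilon.
From Coquelicot Require Import Coquelicot.
Open Scope R_scope.

(** Write [K = M - 1 / M], [a = g1'(0)], [b = g2'(0)] and [zeta = |z|^2 z].  Then
    [F = L zeta + S], where [L zeta = a zeta + conj (b zeta)] is real-linear and
    [S = |z|^2 ((g1 - a z) + conj (g2 - b z))].  Since [||a| - |b|| = 1], [L] does not
    decrease distances ([real_linear_ge]).  The remainder [S], as a function of
    [zeta], has the Lipschitz constant [K (2 r - r^2) / (1 - r)^2] on [|z| <= r]; this
    is below 1 for [r < r3] ([contraction_below_r3]).  Hence [F] is injective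
    ([F_injective]).  Moreover [|S| <= K r^4 / (1 - r)], so for [|w| < sigma3] the map
    [zeta |-> L^-1 (w - S)] is a contraction of a closed disk into itself, and its
    fixed point solves [F z = w] ([F_covers]).

    The estimates for [S] come from one-variable bounds
    ([bounded_function_estimates]) for [f = g1 + u g2] with [|u| = 1], which satisfies
    [|f| <= M], [f 0 = 0] and [|f'(0)| >= 1]; the unimodular [u] is chosen so that
    moduli of the two parts add up ([aligned_sum]).  Schwarz's lemma for [f / (M z)],
    followed by a Moebius map, by Schwarz's lemma again and by the Schwarz-Pick lemma,
    bounds [f z / z - f'(0)] and its difference quotients by the values for
    [K (z + z^2 + ...)].

    No integral is used.  Since [g] is of class C^2, the derivative of [g1] is
    [(g_x - i g_y) / 2], which is of class C^1 and satisfies the Cauchy-Riemann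
    equations; the same holds for [g2] ([components_hol2]).  For functions with two
    complex derivatives the maximum principle follows from the second-derivative test
    applied to [|G|^2 + eps |z|^2], whose Laplacian is positive ([no_interior_max]).
    Singularities are removed by multiplying large powers by a polynomial that vanishes
    at them ([removable_max_principle]).

    For [M = 1] the function [g z = z] is admissible with [F z = |z|^2 z], defined
    only on the unit disk and with values in it, so no larger radius is possible. *)

(** * Complex differentiability *)

Definition ccont (f : C -> C) (z : C) : Prop :=
  forall eps, 0 < eps -> exists del, 0 < del /\
    forall y, Cmod (y - z) < del -> Cmod (f y - f z) < eps.

Lemma Cmod_minus_sym (a b : C) : Cmod (a - b) = Cmod (b - a).
Proof. rewrite <- Cmod_opp. f_equal. ring. Qed.

Lemma Cmod_sub_le (a b : C) : Cmod a - Cmod b <= Cmod (a - b).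
Proof.
  pose proof (Cmod_triangle (a - b) b) as H.
  replace (a - b + b)%C with a in H by ring. lra.
Qed.

Lemma Cmod_sub_triangle (a b : C) : Cmod (a - b) <= Cmod a + Cmod b.
Proof.
  pose proof (Cmod_triangle a (- b)) as H. rewrite Cmod_opp in H. exact H.
Qed.

Lemma Cmod_self_minus (z : C) : Cmod (z - z) = 0.
Proof. replace (z - z)%C with (RtoC 0) by ring. apply Cmod_0. Qed.

Lemma Csub_eq (a b : C) : (a - b)%C = 0 -> a = b.
Proof. intro H. replace a with (b + (a - b))%C by ring. rewrite H. ring. Qed.

Lemma ccont_ext_loc (f g : C -> C) (z : C) (d : R) :
  0 < d -> (forall y, Cmod (y - z) < d -> f y = g y) ->
  ccont f z -> ccont g z.
Proof.
  intros Hd He Hf eps Heps. destruct (Hf eps Heps) as [d' [Hd' H]].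
  exists (Rmin d d'). split; [now apply Rmin_pos|]. intros y Hy.
  pose proof (Rmin_l d d'). pose proof (Rmin_r d d').
  rewrite <- (He y) by lra. rewrite <- (He z) by (rewrite Cmod_self_minus; lra).
  apply H; lra.
Qed.

Lemma ccont_const (c z : C) : ccont (fun _ => c) z.
Proof.
  intros eps He. exists 1. split; [lra|]. intros y _. rewrite Cmod_self_minus. lra.
Qed.

Lemma ccont_id (z : C) : ccont (fun y => y) z.
Proof. intros eps He. exists eps. split; [lra|]. auto. Qed.

Lemma ccont_conj (f : C -> C) (z : C) : ccont f z -> ccont (fun y => Cconj (f y)) z.
Proof.
  intros Hf eps He. destruct (Hf eps He) as [d [Hd H]]. exists d. split; [lra|].
  intros y Hy. rewrite <- Cminus_conj, Cmod_conj. auto.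
Qed.

Lemma ccont_plus (f g : C -> C) (z : C) :
  ccont f z -> ccont g z -> ccont (fun y => f y + g y)%C z.
Proof.
  intros Hf Hg eps He.
  destruct (Hf (eps / 2)) as [d1 [Hd1 H1]]; [lra|].
  destruct (Hg (eps / 2)) as [d2 [Hd2 H2]]; [lra|].
  exists (Rmin d1 d2). split; [now apply Rmin_pos|]. intros y Hy.
  pose proof (Rmin_l d1 d2). pose proof (Rmin_r d1 d2).
  specialize (H1 y ltac:(lra)). specialize (H2 y ltac:(lra)).
  replace (f y + g y - (f z + g z))%C with ((f y - f z) + (g y - g z))%C by ring.
  eapply Rle_lt_trans; [apply Cmod_triangle|lra].
Qed.

Lemma ccont_mult (f g : C -> C) (z : C) :
  ccont f z -> ccont g z -> ccont (fun y => f y * g y)%C z.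
Proof.
  intros Hf Hg eps He.
  pose proof (Cmod_ge_0 (f z)) as Hfz. pose proof (Cmod_ge_0 (g z)) as Hgz.
  set (B := Cmod (f z) + Cmod (g z) + 1).
  assert (HB : 0 < B) by (unfold B; lra).
  assert (HeB : 0 < eps / (2 * B)) by (apply Rdiv_lt_0_compat; lra).
  destruct (Hf (eps / (2 * B))) as [d1 [Hd1 H1]]; [lra|].
  destruct (Hg (Rmin 1 (eps / (2 * B)))) as [d2 [Hd2 H2]]; [apply Rmin_pos; lra|].
  exists (Rmin d1 d2). split; [now apply Rmin_pos|]. intros y Hy.
  pose proof (Rmin_l d1 d2). pose proof (Rmin_r d1 d2).
  pose proof (Rmin_l 1 (eps / (2 * B))). pose proof (Rmin_r 1 (eps / (2 * B))).
  specialize (H1 y ltac:(lra)). specialize (H2 y ltac:(lra)).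
  replace (f y * g y - f z * g z)%C
    with ((f y - f z) * g y + f z * (g y - g z))%C by ring.
  pose proof (Cmod_triangle ((f y - f z) * g y) (f z * (g y - g z))) as HT.
  rewrite !Cmod_mult in HT.
  pose proof (Cmod_sub_le (g y) (g z)).
  pose proof (Cmod_ge_0 (f y - f z)). pose proof (Cmod_ge_0 (g y - g z)).
  pose proof (Cmod_ge_0 (g y)).
  assert (E : eps / (2 * B) * (2 * B) = eps) by (field; lra).
  set (e := eps / (2 * B)) in *.
  assert (Cmod (f y - f z) * Cmod (g y) <= e * B).
  { apply Rmult_le_compat; unfold B; lra. }
  assert (Cmod (f z) * Cmod (g y - g z) < e * B).
  { assert (Cmod (f z) * Cmod (g y - g z) <= Cmod (f z) * e)
      by (apply Rmult_le_compat_l; lra).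
    assert (e * Cmod (f z) < e * B) by (apply Rmult_lt_compat_l; unfold B; lra). lra. }
  lra.
Qed.

Lemma ccont_neq_0 (f : C -> C) (z : C) : ccont f z -> f z <> 0 ->
  exists d, 0 < d /\ forall y, Cmod (y - z) < d -> Cmod (f z) / 2 < Cmod (f y).
Proof.
  intros Hf Hz. apply Cmod_gt_0 in Hz.
  destruct (Hf (Cmod (f z) / 2)) as [d [Hd H]]; [lra|].
  exists d. split; [lra|]. intros y Hy. specialize (H y Hy).
  rewrite Cmod_minus_sym in H. pose proof (Cmod_sub_le (f z) (f y)). lra.
Qed.

Lemma ccont_inv (f : C -> C) (z : C) :
  ccont f z -> f z <> 0 -> ccont (fun y => / f y)%C z.
Proof.
  intros Hf Hz eps He. destruct (ccont_neq_0 f z Hf Hz) as [d1 [Hd1 H1]].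
  pose proof (proj1 (Cmod_gt_0 _) Hz) as Hp.
  set (m := Cmod (f z)) in *.
  destruct (Hf (eps * (m * m / 2))) as [d2 [Hd2 H2]].
  { apply Rmult_lt_0_compat; nra. }
  exists (Rmin d1 d2). split; [now apply Rmin_pos|]. intros y Hy.
  pose proof (Rmin_l d1 d2). pose proof (Rmin_r d1 d2).
  specialize (H1 y ltac:(lra)). specialize (H2 y ltac:(lra)).
  assert (Hy0 : f y <> 0) by (apply Cmod_gt_0; lra).
  replace (/ f y - / f z)%C with ((f z - f y) / (f y * f z))%C by (field; auto).
  rewrite Cmod_div by (apply Cmult_neq_0; auto).
  rewrite Cmod_mult, Cmod_minus_sym. fold m.
  apply Rlt_div_l; [nra|].
  eapply Rlt_le_trans; [exact H2|]. apply Rmult_le_compat_l; [lra|]. nra.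
Qed.

(** The difference quotient extends continuously by [l] (Caratheodory's form of the
    derivative); products and inverses then reduce to the algebra of continuous
    functions. *)
Definition cderiv (f : C -> C) (z l : C) : Prop :=
  exists (q : C -> C) (d : R), 0 < d /\ ccont q z /\ q z = l /\
    forall y, Cmod (y - z) < d -> f y = (f z + q y * (y - z))%C.

Lemma cderiv_ccont (f : C -> C) (z l : C) : cderiv f z l -> ccont f z.
Proof.
  intros [q [d [Hd [Hq [_ H]]]]].
  apply ccont_ext_loc with (f := fun y => (f z + q y * (y + - z))%C) (d := d); auto.
  - intros y Hy. symmetry. apply H. exact Hy.
  - apply ccont_plus; [apply ccont_const|]. apply ccont_mult; auto.
    apply ccont_plus; [apply ccont_id|apply ccont_const].
Qed.

Lemma cderiv_ext_loc (f g : C -> C) (z l : C) (d : R) :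
  0 < d -> (forall y, Cmod (y - z) < d -> f y = g y) ->
  cderiv f z l -> cderiv g z l.
Proof.
  intros Hd He [q [d' [Hd' [Hq [Hl H]]]]].
  exists q, (Rmin d d'). split; [now apply Rmin_pos|]. repeat split; auto.
  intros y Hy. pose proof (Rmin_l d d'). pose proof (Rmin_r d d').
  rewrite <- He by lra. rewrite <- He by (rewrite Cmod_self_minus; lra).
  apply H; lra.
Qed.

Lemma cderiv_const (c z : C) : cderiv (fun _ => c) z 0.
Proof.
  exists (fun _ => RtoC 0), 1. repeat split; [lra|apply ccont_const|].
  intros. ring.
Qed.

Lemma cderiv_id (z : C) : cderiv (fun y => y) z 1.
Proof.
  exists (fun _ => RtoC 1), 1. repeat split; [lra|apply ccont_const|].
  intros. ring.
Qed.

Lemma cderiv_plus (f g : C -> C) (z k l : C) :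
  cderiv f z k -> cderiv g z l -> cderiv (fun y => f y + g y)%C z (k + l).
Proof.
  intros [p [d [Hd [Hp [Hk H]]]]] [q [d' [Hd' [Hq [Hl H']]]]].
  exists (fun y => p y + q y)%C, (Rmin d d'). split; [now apply Rmin_pos|].
  split; [now apply ccont_plus|]. split; [congruence|].
  intros y Hy. pose proof (Rmin_l d d'). pose proof (Rmin_r d d').
  rewrite (H y), (H' y) by lra. ring.
Qed.

Lemma cderiv_mult (f g : C -> C) (z k l : C) :
  cderiv f z k -> cderiv g z l ->
  cderiv (fun y => f y * g y)%C z (k * g z + f z * l).
Proof.
  intros Hf Hg. pose proof (cderiv_ccont _ _ _ Hg) as Hgc.
  destruct Hf as [p [d [Hd [Hp [Hk H]]]]]. destruct Hg as [q [d' [Hd' [Hq [Hl H']]]]].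
  exists (fun y => p y * g y + f z * q y)%C, (Rmin d d'). split; [now apply Rmin_pos|].
  split.
  { apply ccont_plus; apply ccont_mult; auto using ccont_const. }
  split; [congruence|].
  intros y Hy. pose proof (Rmin_l d d'). pose proof (Rmin_r d d').
  rewrite (H y), (H' y) by lra. ring.
Qed.

Lemma cderiv_inv (f : C -> C) (z l : C) :
  cderiv f z l -> f z <> 0 -> cderiv (fun y => / f y)%C z (- l * (/ f z * / f z)).
Proof.
  intros Hf Hz. pose proof (cderiv_ccont _ _ _ Hf) as Hfc.
  destruct (ccont_neq_0 f z Hfc Hz) as [d1 [Hd1 H1]].
  destruct Hf as [p [d [Hd [Hp [Hk H]]]]].
  exists (fun y => (- (1)) * p y * (/ f z * / f y))%C, (Rmin d d1).
  split; [now apply Rmin_pos|].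
  split.
  { apply ccont_mult; [apply ccont_mult; auto using ccont_const|].
    apply ccont_mult; [apply ccont_const|now apply ccont_inv]. }
  split; [rewrite Hk; ring|].
  intros y Hy. pose proof (Rmin_l d d1). pose proof (Rmin_r d d1).
  specialize (H1 y ltac:(lra)). specialize (H y ltac:(lra)).
  pose proof (Cmod_ge_0 (f z)).
  assert (Hy0 : f y <> 0) by (apply Cmod_gt_0; lra).
  replace (- (1) * p y * (/ f z * / f y) * (y - z))%C
    with (- (1) * (/ f z * / f y) * (p y * (y - z)))%C by ring.
  replace (p y * (y - z))%C with (f y - f z)%C by (rewrite H; ring).
  field; auto.
Qed.

(** Two complex derivatives are what the second-derivative test behind the maximum
    principle uses; analytic functions have them, but by a theorem that needs
    integration, whereas here they come from the C^2 regularity of [g]. *)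
Definition hol2 (D : C -> Prop) (f : C -> C) : Prop :=
  exists f1 : C -> C, forall z, D z ->
    cderiv f z (f1 z) /\ exists l, cderiv f1 z l.

Lemma hol2_const (D : C -> Prop) (c : C) : hol2 D (fun _ => c).
Proof.
  exists (fun _ => RtoC 0). intros z _. split; [apply cderiv_const|].
  exists (RtoC 0). apply cderiv_const.
Qed.

Lemma hol2_id (D : C -> Prop) : hol2 D (fun z => z).
Proof.
  exists (fun _ => RtoC 1). intros z _. split; [apply cderiv_id|].
  exists (RtoC 0). apply cderiv_const.
Qed.

Lemma hol2_plus (D : C -> Prop) (f g : C -> C) :
  hol2 D f -> hol2 D g -> hol2 D (fun z => f z + g z)%C.
Proof.
  intros [f1 Hf] [g1 Hg]. exists (fun z => f1 z + g1 z)%C. intros z Hz.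
  destruct (Hf z Hz) as [Hf1 [l Hl]]. destruct (Hg z Hz) as [Hg1 [k Hk]].
  split; [now apply cderiv_plus|]. exists (l + k)%C. now apply cderiv_plus.
Qed.

Lemma hol2_mult (D : C -> Prop) (f g : C -> C) :
  hol2 D f -> hol2 D g -> hol2 D (fun z => f z * g z)%C.
Proof.
  intros [f1 Hf] [g1 Hg]. exists (fun z => f1 z * g z + f z * g1 z)%C. intros z Hz.
  destruct (Hf z Hz) as [Hf1 [l Hl]]. destruct (Hg z Hz) as [Hg1 [k Hk]].
  split; [now apply cderiv_mult|].
  eexists. apply cderiv_plus; apply cderiv_mult; eassumption.
Qed.

Lemma hol2_inv (D : C -> Prop) (f : C -> C) :
  hol2 D f -> (forall z, D z -> f z <> 0) -> hol2 D (fun z => / f z)%C.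
Proof.
  intros [f1 Hf] Hn. exists (fun z => 0 + - (1) * f1 z * (/ f z * / f z))%C.
  intros z Hz.
  destruct (Hf z Hz) as [Hf1 [l Hl]]. split.
  - replace (0 + - (1) * f1 z * (/ f z * / f z))%C
      with (- f1 z * (/ f z * / f z))%C by ring.
    apply cderiv_inv; auto.
  - eexists. apply cderiv_plus; [apply cderiv_const|].
    apply cderiv_mult.
    + apply cderiv_mult; [apply cderiv_const|eassumption].
    + apply cderiv_mult; apply cderiv_inv; auto; eassumption.
Qed.

Lemma hol2_ext (D : C -> Prop) (f g : C -> C) :
  (forall z, f z = g z) -> hol2 D f -> hol2 D g.
Proof.
  intros He [f1 Hf]. exists f1. intros z Hz. destruct (Hf z Hz) as [H1 H2].
  split; auto. now apply (cderiv_ext_loc f) with (d := 1); [lra| |].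
Qed.

Lemma hol2_sub (D E : C -> Prop) (f : C -> C) :
  (forall z, D z -> E z) -> hol2 E f -> hol2 D f.
Proof. intros H [f1 Hf]. exists f1. auto. Qed.

Lemma hol2_pow (D : C -> Prop) (f : C -> C) (n : nat) :
  hol2 D f -> hol2 D (fun z => f z ^ n)%C.
Proof.
  intro Hf. induction n as [|n IH].
  - apply hol2_ext with (fun _ => RtoC 1); [reflexivity|apply hol2_const].
  - apply hol2_ext with (fun z => f z * f z ^ n)%C; [reflexivity|now apply hol2_mult].
Qed.

(** * Maxima on closed disks *)

Lemma Cmod_lt_of_coordinates (c : C) (d : R) :
  Rabs (fst c) < d -> Rabs (snd c) < d -> Cmod c < 2 * d.
Proof.
  intros H1 H2. eapply Rle_lt_trans; [apply Cmod_2Rmax|].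
  assert (Rmax (Rabs (fst c)) (Rabs (snd c)) < d) by (apply Rmax_lub_lt; assumption).
  assert (0 <= Rmax (Rabs (fst c)) (Rabs (snd c)))
    by (eapply Rle_trans; [apply Rabs_pos|apply Rmax_l]).
  assert (sqrt 2 <= 2)
    by (rewrite <- (sqrt_square 2) at 2 by lra; apply sqrt_le_1; lra).
  pose proof (sqrt_pos 2). nra.
Qed.

(** Compactness: a property that holds near every point with a gauge depending on
    the point, and that persists for smaller gauges, holds with one gauge. *)
Lemma disc_uniform_gauge (rho : R) (P : C -> R -> Prop) :
  (forall y d d', 0 < d' <= d -> P y d -> P y d') ->
  (forall p, Cmod p <= rho -> exists d, 0 < d /\
     forall y, Cmod y <= rho -> Cmod (y - p) < d -> P y d) ->
  exists d, 0 < d /\ forall y, Cmod y <= rho -> P y d.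
Proof.
  intros Hmon Hloc.
  assert (Hall : forall p, exists d : posreal,
     forall y, Cmod y <= rho -> Cmod (y - p) < 2 * d -> P y d).
  { intro p. destruct (Rle_lt_dec (Cmod p) rho) as [Hp|Hp].
    - destruct (Hloc p Hp) as [d [Hd H]].
      exists (mkposreal (d / 2) ltac:(lra)). simpl. intros y Hy Hyp.
      apply (Hmon y d); [lra|]. apply H; lra.
    - exists (mkposreal ((Cmod p - rho) / 2) ltac:(lra)). simpl. intros y Hy Hyp.
      rewrite Cmod_minus_sym in Hyp. pose proof (Cmod_sub_le p y). lra. }
  set (delta := fun u v : R =>
        proj1_sig (constructive_indefinite_description _ (Hall (u, v)))).
  destruct (compactness_value_2d (- rho) rho (- rho) rho delta) as [d Hd].
  exists d. split; [apply cond_pos|]. intros y Hy.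
  apply NNPP. intro HN.
  assert (H1 : - rho <= fst y <= rho /\ - rho <= snd y <= rho).
  { pose proof (Rmax_Cmod y). pose proof (Rmax_l (Rabs (fst y)) (Rabs (snd y))).
    pose proof (Rmax_r (Rabs (fst y)) (Rabs (snd y))).
    split; apply Rabs_le_between; lra. }
  apply (Hd (fst y) (snd y) (proj1 H1) (proj2 H1)).
  intros [u [v [Hu [Hv [Hxu [Hyv Hdd]]]]]].
  apply HN. revert Hxu Hyv Hdd. unfold delta.
  destruct (constructive_indefinite_description _ (Hall (u, v))) as [d' Hd']. simpl.
  intros Hxu Hyv Hdd.
  apply (Hmon y d'); [split; [apply cond_pos|exact Hdd]|]. apply Hd'; [exact Hy|].
  now apply Cmod_lt_of_coordinates.
Qed.

(** If the supremum [s] were not attained, [u <= s - d] would hold near each point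
    for some [d], hence everywhere for a single [d]. *)
Lemma disc_max (rho : R) (u : C -> R) :
  0 <= rho ->
  (forall z, Cmod z <= rho -> forall eps, 0 < eps -> exists d, 0 < d /\
     forall y, Cmod y <= rho -> Cmod (y - z) < d -> u y < u z + eps) ->
  exists z0, Cmod z0 <= rho /\ forall z, Cmod z <= rho -> u z <= u z0.
Proof.
  intros Hrho Hc'.
  assert (Hb : exists d, 0 < d /\ forall y, Cmod y <= rho -> u y <= / d).
  { apply disc_uniform_gauge.
    - intros y d d' Hd H. assert (/ d <= / d') by (apply Rinv_le_contravar; lra). lra.
    - intros p Hp. destruct (Hc' p Hp 1 ltac:(lra)) as [d [Hd H]].
      set (B := Rabs (u p) + 1). pose proof (Rabs_pos (u p)). pose proof (Rle_abs (u p)).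
      exists (Rmin d (/ B)).
      assert (0 < / B) by (apply Rinv_0_lt_compat; unfold B; lra).
      split; [now apply Rmin_pos|]. intros y Hy Hyp.
      pose proof (Rmin_l d (/ B)). pose proof (Rmin_r d (/ B)).
      specialize (H y Hy ltac:(lra)).
      assert (HBd : / / B <= / Rmin d (/ B)).
      { apply Rinv_le_contravar; [now apply Rmin_pos|assumption]. }
      rewrite Rinv_inv in HBd. unfold B in *. lra. }
  destruct Hb as [d0 [Hd0 Hb]].
  destruct (completeness (fun r => exists z, Cmod z <= rho /\ r = u z)) as [s [Hs1 Hs2]].
  { exists (/ d0). intros r [z [Hz ->]]. auto. }
  { exists (u 0). exists (RtoC 0). rewrite Cmod_0. auto. }
  apply NNPP. intro HN.
  assert (Hlt : forall z, Cmod z <= rho -> u z < s).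
  { intros z Hz. destruct (Rle_lt_or_eq_dec (u z) s) as [H|H]; auto.
    - apply Hs1. eauto.
    - exfalso. apply HN. exists z. split; auto. intros y Hy. rewrite H.
      apply Hs1. eauto. }
  destruct (disc_uniform_gauge rho (fun y d => u y <= s - d)) as [d [Hd H]].
  - intros; lra.
  - intros p Hp. specialize (Hlt p Hp).
    destruct (Hc' p Hp ((s - u p) / 2) ltac:(lra)) as [d [Hd H]].
    exists (Rmin d ((s - u p) / 2)). split; [apply Rmin_pos; lra|].
    intros y Hy Hyp.
    pose proof (Rmin_l d ((s - u p) / 2)). pose proof (Rmin_r d ((s - u p) / 2)).
    specialize (H y Hy ltac:(lra)). lra.
  - assert (s <= s - d); [|lra]. apply Hs2. intros r [z [Hz ->]]. auto.
Qed.

(** * The maximum principle *)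

Lemma second_derivative_at_max (p p1 : R -> R) (m d : R) :
  0 < d -> (forall t, Rabs t < d -> is_derive p t (p1 t)) ->
  is_derive p1 0 m -> (forall t, Rabs t < d -> p t <= p 0) -> m <= 0.
Proof.
  intros Hd Hp Hm Hmax. apply Rnot_lt_le. intro Hpos.
  assert (H0 : p1 0 = 0).
  { assert (D0 : derivable_pt_lim p 0 (p1 0)).
    { apply is_derive_Reals. apply Hp. rewrite Rabs_R0. lra. }
    pose (pr := exist _ (p1 0) D0 : derivable_pt p 0).
    change (derive_pt p 0 pr = 0).
    apply (deriv_maximum p (- d) d 0 pr); try lra.
    intros x H1 H2. apply Hmax. apply Rabs_def1; lra. }
  apply is_derive_Reals in Hm.
  destruct (Hm m Hpos) as [e He].
  set (t := Rmin (d / 2) (e / 2)).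
  assert (Ht : 0 < t) by (apply Rmin_pos; [lra|pose proof (cond_pos e); lra]).
  assert (Htd : t <= d / 2) by apply Rmin_l. assert (Hte : t <= e / 2) by apply Rmin_r.
  pose proof (cond_pos e).
  assert (Hsign : forall s, 0 < s <= t -> 0 < p1 s).
  { intros s Hs. specialize (He s ltac:(lra)).
    rewrite Rabs_pos_eq in He by lra. specialize (He ltac:(lra)).
    rewrite Rplus_0_l, H0, Rminus_0_r in He. apply Rabs_def2 in He.
    assert (0 < p1 s / s) by lra.
    replace (p1 s) with (p1 s / s * s) by (field; lra). apply Rmult_lt_0_compat; lra. }
  destruct (MVT_cor2 p p1 0 t Ht) as [s [Hs1 Hs2]].
  { intros c Hc. apply is_derive_Reals, Hp. rewrite Rabs_pos_eq; lra. }
  assert (p t <= p 0) by (apply Hmax; rewrite Rabs_pos_eq; lra).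
  specialize (Hsign s ltac:(lra)). nra.
Qed.

Lemma cderiv_along (f : C -> C) (z l e : C) (t : R) :
  cderiv f (z + t * e)%C l ->
  is_derive (fun s : R => Re (f (z + s * e)%C)) t (Re (l * e)%C) /\
  is_derive (fun s : R => Im (f (z + s * e)%C)) t (Im (l * e)%C).
Proof.
  intros [q [d [Hd [Hq [Hl H]]]]].
  assert (K : forall eps : posreal, exists del : posreal, forall h, Rabs h < del ->
     Cmod (f (z + (t + h)%R * e) - f (z + t * e) - h * (l * e))%C <= eps * Rabs h).
  { intro eps. pose proof (Cmod_ge_0 e) as He.
    destruct (Hq (eps / (Cmod e + 1))) as [d' [Hd' Hq']].
    { apply Rdiv_lt_0_compat; [apply cond_pos|lra]. }
    assert (Hm : 0 < Rmin d d' / (Cmod e + 1)).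
    { apply Rdiv_lt_0_compat; [now apply Rmin_pos|lra]. }
    exists (mkposreal _ Hm). simpl. intros h Hh.
    assert (Hy : (z + (t + h)%R * e - (z + t * e))%C = (h * e)%C)
      by (rewrite RtoC_plus; ring).
    assert (Hy' : Cmod (h * e) < Rmin d d').
    { rewrite Cmod_mult, Cmod_R. apply Rlt_div_r in Hh; [|lra].
      pose proof (Rabs_pos h). nra. }
    pose proof (Rmin_l d d'). pose proof (Rmin_r d d').
    rewrite (H (z + (t + h)%R * e)%C) by (rewrite Hy; lra).
    specialize (Hq' (z + (t + h)%R * e)%C). rewrite Hy in *. specialize (Hq' ltac:(lra)).
    rewrite Hl in Hq'.
    match goal with |- Cmod ?x <= _ =>
      replace x with ((q (z + (t + h)%R * e) - l) * (h * e))%C by ring end.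
    rewrite !Cmod_mult, Cmod_R.
    assert (Cmod (q (z + (t + h)%R * e) - l)%C * Cmod e <= eps).
    { assert (eps / (Cmod e + 1) * (Cmod e + 1) = eps) by (field; lra).
      pose proof (Cmod_ge_0 (q (z + (t + h)%R * e)%C - l)%C). nra. }
    pose proof (Rabs_pos h). nra. }
  assert (im_le : forall c, Rabs (Im c) <= Cmod c).
  { intro c. pose proof (Rmax_Cmod c). pose proof (Rmax_r (Rabs (fst c)) (Rabs (snd c))).
    unfold Im. lra. }
  split; apply is_derive_Reals; intros eps He;
    destruct (K (mkposreal (eps / 2) ltac:(lra))) as [del Hdel]; exists del;
    intros h Hh0 Hh; specialize (Hdel h Hh); simpl in Hdel;
    pose proof (Rabs_pos_lt h Hh0).
  - replace ((Re (f (z + (t + h)%R * e)%C) - Re (f (z + t * e)%C)) / h - Re (l * e))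
     with (Re (f (z + (t + h)%R * e) - f (z + t * e) - h * (l * e))%C / h).
    + unfold Rdiv. rewrite Rabs_mult, Rabs_inv.
      apply (Rmult_lt_reg_r (Rabs h)); auto. rewrite Rmult_assoc, Rinv_l by lra.
      pose proof (re_le_Cmod (f (z + (t + h)%R * e) - f (z + t * e) - h * (l * e))%C).
      nra.
    + rewrite Rdiv_def. unfold Cminus. rewrite !re_plus, !re_opp, re_scal_l. field. auto.
  - replace ((Im (f (z + (t + h)%R * e)%C) - Im (f (z + t * e)%C)) / h - Im (l * e))
     with (Im (f (z + (t + h)%R * e) - f (z + t * e) - h * (l * e))%C / h).
    + unfold Rdiv. rewrite Rabs_mult, Rabs_inv.
      apply (Rmult_lt_reg_r (Rabs h)); auto. rewrite Rmult_assoc, Rinv_l by lra.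
      pose proof (im_le (f (z + (t + h)%R * e) - f (z + t * e) - h * (l * e))%C).
      nra.
    + rewrite Rdiv_def. unfold Cminus. rewrite !im_plus, !im_opp, im_scal_l. field. auto.
Qed.

(** The second derivative of [t |-> |G (z0 + t e)|^2 + eps |z0 + t e|^2] at its
    maximum [t = 0], divided by 2. *)
Lemma directional_second_derivative (G G1 : C -> C) (z0 l e : C) (eps d : R) :
  Cmod e = 1 -> 0 < d ->
  (forall y, Cmod (y - z0) < d -> cderiv G y (G1 y)) -> cderiv G1 z0 l ->
  (forall y, Cmod (y - z0) < d ->
     Cmod (G y) ^ 2 + eps * Cmod y ^ 2 <= Cmod (G z0) ^ 2 + eps * Cmod z0 ^ 2) ->
  Cmod (G1 z0 * e) ^ 2 + Re (G z0) * Re (l * e * e)%C + Im (G z0) * Im (l * e * e)%C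
    + eps <= 0.
Proof.
  intros He Hd HG Hl Hmax.
  assert (Hloc : forall t, Rabs t < d -> Cmod (z0 + t * e - z0)%C < d).
  { intros t Ht. replace (z0 + t * e - z0)%C with (t * e)%C by ring.
    rewrite Cmod_mult, Cmod_R, He. lra. }
  assert (Hz : (z0 + 0%R * e)%C = z0) by ring.
  assert (HG1e : cderiv (fun y => G1 y * e)%C (z0 + 0%R * e)%C (l * e)%C).
  { rewrite Hz. replace (l * e)%C with (l * e + G1 z0 * 0)%C by ring.
    apply (cderiv_mult G1 (fun _ => e)); auto using cderiv_const. }
  destruct (cderiv_along _ _ _ _ _ HG1e) as [HR2 HI2].
  pose (a := fun t : R => Re (G (z0 + t * e)%C)).
  pose (b := fun t : R => Im (G (z0 + t * e)%C)).
  pose (a1 := fun t : R => Re (G1 (z0 + t * e)%C * e)%C).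
  pose (b1 := fun t : R => Im (G1 (z0 + t * e)%C * e)%C).
  assert (Ha : forall t, Rabs t < d -> is_derive a t (a1 t)).
  { intros t Ht. apply (proj1 (cderiv_along _ _ _ _ _ (HG _ (Hloc t Ht)))). }
  assert (Hb : forall t, Rabs t < d -> is_derive b t (b1 t)).
  { intros t Ht. apply (proj2 (cderiv_along _ _ _ _ _ (HG _ (Hloc t Ht)))). }
  pose (p := fun t : R => (a t ^ 2 + b t ^ 2)
      + eps * ((Re z0 + t * Re e) ^ 2 + (Im z0 + t * Im e) ^ 2)).
  pose (p1 := fun t : R => (2 * (a t * a1 t) + 2 * (b t * b1 t))
      + eps * (2 * (Re z0 + t * Re e) * Re e + 2 * (Im z0 + t * Im e) * Im e)).
  assert (Hpe : forall t, p t = Cmod (G (z0 + t * e)%C) ^ 2 + eps * Cmod (z0 + t * e)%C ^ 2).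
  { intro t. unfold p, a, b. rewrite !Cmod2_alt, !re_plus, !im_plus, re_scal_l, im_scal_l.
    ring. }
  assert (H0 : Rabs 0 < d) by (rewrite Rabs_R0; lra).
  assert (He2 : Re e ^ 2 + Im e ^ 2 = 1) by (rewrite <- Cmod2_alt, He; ring).
  assert (Ha1 : is_derive a1 0 (Re (l * e * e)%C)) by exact HR2.
  assert (Hb1 : is_derive b1 0 (Im (l * e * e)%C)) by exact HI2.
  replace (Cmod (G1 z0 * e) ^ 2) with (a1 0 * a1 0 + b1 0 * b1 0)
    by (unfold a1, b1; rewrite Cmod2_alt, Hz; ring).
  replace (Re (G z0)) with (a 0) by (unfold a; now rewrite Hz).
  replace (Im (G z0)) with (b 0) by (unfold b; now rewrite Hz).
  assert (Hpmax : forall t, Rabs t < d -> p t <= p 0).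
  { intros t Ht. rewrite !Hpe, Hz. apply Hmax. auto. }
  clear Hpe HR2 HI2. clearbody a b a1 b1.
  enough (Hle : 2 * (a1 0 * a1 0 + a 0 * Re (l * e * e)%C)
     + 2 * (b1 0 * b1 0 + b 0 * Im (l * e * e)%C) + eps * 2 <= 0) by lra.
  apply (second_derivative_at_max p p1 _ d Hd); auto.
  - intros t Ht. unfold p, p1. specialize (Ha t Ht). specialize (Hb t Ht).
    auto_derive.
    + repeat split; eexists; eassumption.
    + replace (Derive (fun x : R => a x) t) with (a1 t)
        by (symmetry; now apply is_derive_unique).
      replace (Derive (fun x : R => b x) t) with (b1 t)
        by (symmetry; now apply is_derive_unique). ring.
  - unfold p1. specialize (Ha 0 H0). specialize (Hb 0 H0). auto_derive.
    + repeat split; eexists; eassumption.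
    + replace (Derive (fun x : R => a x) 0) with (a1 0)
        by (symmetry; now apply is_derive_unique).
      replace (Derive (fun x : R => b x) 0) with (b1 0)
        by (symmetry; now apply is_derive_unique).
      replace (Derive (fun x : R => a1 x) 0) with (Re (l * e * e)%C)
        by (symmetry; now apply is_derive_unique).
      replace (Derive (fun x : R => b1 x) 0) with (Im (l * e * e)%C)
        by (symmetry; now apply is_derive_unique).
      replace (eps * 2) with (eps * 2 * (Re e ^ 2 + Im e ^ 2)) by (rewrite He2; ring).
      ring.
Qed.

(** The directions [1] and [Ci] make up the Laplacian: the contributions of the
    second derivative [l] cancel because [Ci^2 = -1], leaving
    [2 |G1 z0|^2 + 2 eps > 0]. *)
Lemma no_interior_max (G G1 : C -> C) (z0 l : C) (eps d : R) :
  0 < eps -> 0 < d ->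
  (forall y, Cmod (y - z0) < d -> cderiv G y (G1 y)) -> cderiv G1 z0 l ->
  ~ (forall y, Cmod (y - z0) < d ->
     Cmod (G y) ^ 2 + eps * Cmod y ^ 2 <= Cmod (G z0) ^ 2 + eps * Cmod z0 ^ 2).
Proof.
  intros He Hd HG Hl Hmax.
  pose proof (directional_second_derivative G G1 z0 l 1 eps d Cmod_1 Hd HG Hl Hmax) as H1.
  pose proof (directional_second_derivative G G1 z0 l Ci eps d Cmod_Ci Hd HG Hl Hmax) as H2.
  replace (l * 1 * 1)%C with l in H1 by ring.
  replace (l * Ci * Ci)%C with (- l)%C in H2
    by (unfold Ci; apply injective_projections; simpl; ring).
  rewrite re_opp, im_opp in H2.
  pose proof (pow2_ge_0 (Cmod (G1 z0 * 1))). pose proof (pow2_ge_0 (Cmod (G1 z0 * Ci))).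
  lra.
Qed.

Lemma le_of_le_plus_eps (a b c : R) :
  0 <= c -> (forall eps, 0 < eps -> a <= b + eps * c) -> a <= b.
Proof.
  intros Hc H. apply Rnot_lt_le. intro Hlt.
  specialize (H ((a - b) / (2 * (c + 1))) ltac:(apply Rdiv_lt_0_compat; lra)).
  assert ((a - b) / (2 * (c + 1)) * (c + 1) = (a - b) / 2) by (field; lra).
  assert (0 < (a - b) / (2 * (c + 1))) by (apply Rdiv_lt_0_compat; lra).
  nra.
Qed.

(** A point where [G] vanishes cannot spoil the bound at a maximum, so [G] need not be
    differentiable there; this leaves room for removable singularities. *)
Lemma max_principle (G : C -> C) (U : C -> Prop) (rho A : R) :
  0 <= rho -> 0 <= A ->
  (forall z, Cmod z <= rho -> ccont G z) ->
  (forall z, U z -> exists d, 0 < d /\ forall y, Cmod (y - z) < d -> U y) ->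
  hol2 U G ->
  (forall z, Cmod z < rho -> U z \/ G z = 0) ->
  (forall z, Cmod z = rho -> Cmod (G z) <= A) ->
  forall z, Cmod z <= rho -> Cmod (G z) <= A.
Proof.
  intros Hrho HA Hc HU [G1 HG] Hin Hbd z Hz.
  apply Rsqr_incr_0_var; [|assumption]. rewrite !Rsqr_pow2.
  apply (le_of_le_plus_eps _ _ (rho ^ 2)); [apply pow2_ge_0|]. intros eps He.
  destruct (disc_max rho (fun y => Cmod (G y) ^ 2 + eps * Cmod y ^ 2) Hrho)
    as [z0 [Hz0 Hmax]].
  { intros y Hy e He'.
    assert (Hcont : ccont (fun x => (G x * Cconj (G x) + eps * (x * Cconj x))%C) y).
    { apply ccont_plus; [apply ccont_mult; auto using ccont_conj|].
      apply ccont_mult; [apply ccont_const|].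
      apply ccont_mult; [|apply (ccont_conj (fun t => t))]; apply ccont_id. }
    destruct (Hcont e He') as [d [Hd H]]. exists d. split; auto. intros x _ Hx.
    specialize (H x Hx).
    rewrite <- !Cmod2_conj, <- !RtoC_mult, <- !RtoC_plus, <- RtoC_minus, Cmod_R in H.
    apply Rabs_def2 in H. lra. }
  assert (Hsq : Cmod z0 ^ 2 <= rho ^ 2).
  { apply pow_incr. split; [apply Cmod_ge_0|assumption]. }
  assert (HA2 : 0 <= A ^ 2) by apply pow2_ge_0.
  assert (Hz2 : 0 <= eps * Cmod z ^ 2)
    by (apply Rmult_le_pos; [lra|apply pow2_ge_0]).
  assert (Hsq' : eps * Cmod z0 ^ 2 <= eps * rho ^ 2) by (apply Rmult_le_compat_l; lra).
  pose proof (Hmax z Hz) as Hmz. simpl in Hmz.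
  assert (Cmod (G z0) ^ 2 <= A ^ 2); [|lra].
  destruct (Rle_lt_or_eq_dec _ _ Hz0) as [Hlt|Heq].
  - destruct (Hin z0 Hlt) as [Hu|H0].
    + exfalso. destruct (HU z0 Hu) as [d [Hd HUd]].
      destruct (HG z0 Hu) as [_ [l Hl]].
      apply (no_interior_max G G1 z0 l eps (Rmin d (rho - Cmod z0)) He); auto.
      * apply Rmin_pos; lra.
      * intros y Hy. pose proof (Rmin_l d (rho - Cmod z0)).
        apply HG. apply HUd. lra.
      * intros y Hy. apply Hmax. pose proof (Rmin_r d (rho - Cmod z0)).
        pose proof (Cmod_sub_le y z0). lra.
    + rewrite H0, Cmod_0. lra.
  - apply pow_incr. split; [apply Cmod_ge_0|auto].
Qed.

Definition punctured (w z : C) : Prop := Cmod z < 1 /\ z <> 0 /\ z <> w.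

Definition bounded_near (Q : C -> C) (p : C) : Prop :=
  exists B d, 0 < d /\ forall z, z <> p -> Cmod (z - p) < d -> Cmod (Q z) <= B.

Lemma hol2_ccont (D : C -> Prop) (f : C -> C) (z : C) : hol2 D f -> D z -> ccont f z.
Proof. intros [f1 H] Hz. apply (cderiv_ccont f z (f1 z)). now apply H. Qed.

Lemma ccont_mult_bounded (f g : C -> C) (p : C) :
  bounded_near f p -> ccont g p -> g p = 0 -> ccont (fun z => f z * g z)%C p.
Proof.
  intros [B [d [Hd HB]]] Hg H0 eps He.
  pose proof (Rabs_pos B). pose proof (Rle_abs B).
  destruct (Hg (eps / (Rabs B + 1))) as [d' [Hd' Hg']].
  { apply Rdiv_lt_0_compat; lra. }
  exists (Rmin d d'). split; [now apply Rmin_pos|]. intros y Hy.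
  pose proof (Rmin_l d d'). pose proof (Rmin_r d d').
  destruct (classic (y = p)) as [->|Hne].
  - now rewrite Cmod_self_minus.
  - specialize (HB y Hne ltac:(lra)). specialize (Hg' y ltac:(lra)).
    rewrite H0 in *. replace (g y - 0)%C with (g y) in Hg' by ring.
    replace (f y * g y - f p * 0)%C with (f y * g y)%C by ring.
    rewrite Cmod_mult.
    assert (eps / (Rabs B + 1) * (Rabs B + 1) = eps) by (field; lra).
    pose proof (Cmod_ge_0 (f y)). pose proof (Cmod_ge_0 (g y)). 
    assert (0 < eps / (Rabs B + 1)) by (apply Rdiv_lt_0_compat; lra).
    nra.
Qed.

Lemma bounded_near_pow (Q : C -> C) (p : C) (n : nat) :
  bounded_near Q p -> bounded_near (fun z => Q z ^ n)%C p.
Proof.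
  intros [B [d [Hd H]]]. exists (B ^ n), d. split; auto. intros z Hz Hzp.
  rewrite Cmod_pow. apply pow_incr. split; [apply Cmod_ge_0|auto].
Qed.

Lemma pow_bounded_le_1 (x B : R) : 0 <= x -> (forall n, x ^ n <= B) -> x <= 1.
Proof.
  intros Hx H. apply Rnot_lt_le. intro Hlt.
  destruct (Pow_x_infinity x ltac:(rewrite Rabs_pos_eq; lra) (B + 1)) as [N HN].
  specialize (HN N (le_n N)). rewrite Rabs_pos_eq in HN by now apply pow_le.
  specialize (H N). lra.
Qed.

Lemma punctured_open (w z : C) : punctured w z ->
  exists d, 0 < d /\ forall y, Cmod (y - z) < d -> punctured w y.
Proof.
  intros [H1 [H2 H3]]. pose proof (proj1 (Cmod_gt_0 z) H2).
  assert (Hzw : 0 < Cmod (z - w)).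
  { apply Cmod_gt_0. intro E. apply H3. now apply Csub_eq. }
  exists (Rmin (1 - Cmod z) (Rmin (Cmod z) (Cmod (z - w)))).
  split; [repeat apply Rmin_pos; lra|]. intros y Hy.
  pose proof (Rmin_l (1 - Cmod z) (Rmin (Cmod z) (Cmod (z - w)))).
  pose proof (Rmin_r (1 - Cmod z) (Rmin (Cmod z) (Cmod (z - w)))).
  pose proof (Rmin_l (Cmod z) (Cmod (z - w))).
  pose proof (Rmin_r (Cmod z) (Cmod (z - w))).
  repeat split.
  - pose proof (Cmod_sub_le y z). lra.
  - intros ->. rewrite Cmod_minus_sym in Hy. replace (z - 0)%C with z in Hy by ring. lra.
  - intros ->. rewrite Cmod_minus_sym in Hy. lra.
Qed.

(** [Q^n z (z - w)] extends continuously by 0 to the exceptional points, so the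
    maximum principle bounds it by [2 (A + eps)^n] on large circles.  Taking [n]-th
    roots as [n] grows removes the factor [z (z - w)]. *)
Lemma removable_max_principle (Q : C -> C) (w : C) (A B r0 : R) :
  0 <= A -> Cmod w < 1 -> r0 < 1 ->
  hol2 (punctured w) Q -> bounded_near Q 0 -> bounded_near Q w ->
  (forall z, punctured w z -> r0 < Cmod z -> Cmod (Q z) <= A + B * (1 - Cmod z)) ->
  forall z, punctured w z -> Cmod (Q z) <= A.
Proof.
  intros HA Hw Hr0 HQ HB0 HBw Hbd z Hz.
  apply (le_of_le_plus_eps _ _ 1); [lra|]. intros eps He. rewrite Rmult_1_r.
  pose proof (Rabs_pos B) as HB. pose proof (Rle_abs B) as HB'.
  (* |y| = 1 - k is a circle beyond z and w on which |Q| <= A + B k <= A + eps. *)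
  set (m := Rmax (Rmax r0 0) (Rmax (Cmod z) (Cmod w))).
  assert (Hm1 : m < 1).
  { destruct Hz as [Hz _]. repeat apply Rmax_lub_lt; lra. }
  assert (Hm : r0 <= m /\ 0 <= m /\ Cmod z <= m /\ Cmod w <= m).
  { unfold m.
    pose proof (Rmax_l (Rmax r0 0) (Rmax (Cmod z) (Cmod w))).
    pose proof (Rmax_r (Rmax r0 0) (Rmax (Cmod z) (Cmod w))).
    pose proof (Rmax_l r0 0). pose proof (Rmax_r r0 0).
    pose proof (Rmax_l (Cmod z) (Cmod w)). pose proof (Rmax_r (Cmod z) (Cmod w)). lra. }
  set (k := Rmin ((1 - m) / 2) (eps / (Rabs B + 1))).
  assert (Hk : 0 < k).
  { apply Rmin_pos; [lra|apply Rdiv_lt_0_compat; lra]. }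
  assert (Hk1 : k <= (1 - m) / 2) by apply Rmin_l.
  assert (Hk2 : B * k <= eps).
  { assert (k <= eps / (Rabs B + 1)) by apply Rmin_r.
    assert (eps / (Rabs B + 1) * (Rabs B + 1) = eps) by (field; lra). nra. }
  set (rho := 1 - k).
  set (P := fun y : C => (y * (y - w))%C).
  assert (HPc : forall y, ccont P y).
  { intro y. apply ccont_mult; [apply ccont_id|].
    apply (ccont_plus (fun t => t) (fun _ => (- w)%C)); auto using ccont_id, ccont_const. }
  assert (HPz : 0 < Cmod (P z)).
  { apply Cmod_gt_0. destruct Hz as [_ [Hz1 Hz2]].
    apply Cmult_neq_0; auto. intro E. apply Hz2. now apply Csub_eq. }
  assert (Hpunct : forall y, Cmod y < 1 -> punctured w y \/ P y = 0).
  { intros y Hy. destruct (classic (P y = 0)) as [E|E]; [now right|left].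
    repeat split; auto.
    - intros ->. apply E. unfold P. ring.
    - intros ->. apply E. unfold P. ring. }
  assert (Hn : forall n, (Cmod (Q z) / (A + eps)) ^ n <= 2 / Cmod (P z)).
  { intro n.
    assert (HG : Cmod (Q z ^ n * P z)%C <= (A + eps) ^ n * 2).
    { apply (max_principle (fun y => Q y ^ n * P y)%C (punctured w) rho).
      - unfold rho; lra.
      - apply Rmult_le_pos; [apply pow_le; lra|lra].
      - intros y Hy. destruct (Hpunct y) as [Hy'|Hy']; [unfold rho in Hy; lra| |].
        + apply ccont_mult; auto. apply (hol2_ccont (punctured w)); auto using hol2_pow.
        + assert (Hor : y = 0 \/ y = w).
          { destruct (classic (y = 0)) as [|E1]; [now left|].
            destruct (classic (y = w)) as [|E2]; [now right|exfalso].
            revert Hy'. apply Cmult_neq_0; auto. intro E. apply E2. now apply Csub_eq. }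
          apply ccont_mult_bounded; auto. apply bounded_near_pow.
          destruct Hor; subst; auto.
      - apply punctured_open.
      - apply hol2_mult; [now apply hol2_pow|].
        apply hol2_mult; [apply hol2_id|].
        apply (hol2_plus _ (fun t => t) (fun _ => (- w)%C)); auto using hol2_id, hol2_const.
      - intros y Hy. destruct (Hpunct y) as [Hy'|Hy']; [unfold rho in Hy; lra|now left|].
        right. rewrite Hy'. ring.
      - intros y Hy. rewrite Cmod_mult, Cmod_pow.
        apply Rmult_le_compat; try apply Cmod_ge_0.
        + apply pow_le, Cmod_ge_0.
        + apply pow_incr. split; [apply Cmod_ge_0|].
          assert (Hyp : punctured w y).
          { repeat split; [unfold rho in Hy; lra| |]; intros ->;
              [rewrite Cmod_0 in Hy|]; unfold rho in Hy; lra. }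
          specialize (Hbd y Hyp). rewrite Hy in Hbd. unfold rho in Hbd.
          specialize (Hbd ltac:(lra)). lra.
        + unfold P. rewrite Cmod_mult. pose proof (Cmod_sub_triangle y w).
          pose proof (Cmod_ge_0 (y - w)). pose proof (Cmod_ge_0 w).
          assert (Cmod y < 1) by (unfold rho in Hy; lra).
          pose proof (Cmod_ge_0 y). nra.
      - unfold rho. lra. }
    rewrite Cmod_mult, Cmod_pow in HG.
    unfold Rdiv at 1. rewrite Rpow_mult_distr, pow_inv.
    assert (0 < (A + eps) ^ n) by (apply pow_lt; lra).
    apply (Rle_div_r _ _ _ HPz).
    apply (Rmult_le_reg_r ((A + eps) ^ n)); [assumption|].
    replace (Cmod (Q z) ^ n * / (A + eps) ^ n * Cmod (P z) * (A + eps) ^ n)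
      with (Cmod (Q z) ^ n * Cmod (P z)) by (field; lra). lra. }
  pose proof (Cmod_ge_0 (Q z)).
  assert (H1 : Cmod (Q z) / (A + eps) <= 1).
  { apply (pow_bounded_le_1 _ (2 / Cmod (P z))); [|assumption].
    apply Rmult_le_pos; [assumption|]. apply Rlt_le, Rinv_0_lt_compat. lra. }
  apply Rle_div_l in H1; lra.
Qed.

(** * The Schwarz and Schwarz-Pick lemmas *)

Lemma unimodular_rotation (X : C) : exists u, Cmod u = 1 /\ (u * X)%C = Cmod X.
Proof.
  destruct (classic (X = 0)) as [->|H].
  - exists (RtoC 1). rewrite Cmod_0. split; [apply Cmod_1|ring].
  - pose proof (proj1 (Cmod_gt_0 X) H).
    exists (Cconj X * / Cmod X)%C.
    assert (Hn : RtoC (Cmod X) <> 0) by (intro E; apply RtoC_inj in E; lra).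
    split.
    + rewrite Cmod_mult, Cmod_inv, Cmod_conj, Cmod_R, Rabs_pos_eq by (auto; lra).
      field; lra.
    + replace (Cconj X * / Cmod X * X)%C with (X * Cconj X * / Cmod X)%C by ring.
      rewrite <- Cmod2_conj. replace (Cmod X ^ 2) with (Cmod X * Cmod X) by ring.
      rewrite RtoC_mult. field. auto.
Qed.

(** This reduces estimates of [|g1| + |g2|] to the single analytic functions
    [g1 + u g2]. *)
Lemma aligned_sum (X Y : C) : exists u, Cmod u = 1 /\ Cmod X + Cmod Y = Cmod (X + u * Y)%C.
Proof.
  destruct (unimodular_rotation X) as [a [Ha HX]].
  destruct (unimodular_rotation Y) as [b [Hb HY]].
  assert (Ha0 : a <> 0) by (apply Cmod_gt_0; lra).
  exists (b / a)%C. split.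
  - rewrite Cmod_div, Ha, Hb by auto. lra.
  - rewrite <- (Rmult_1_l (Cmod (X + _))), <- Ha, <- Cmod_mult.
    replace (a * (X + b / a * Y))%C with (a * X + b * Y)%C by (field; auto).
    rewrite HX, HY, <- RtoC_plus, Cmod_R, Rabs_pos_eq; auto.
    pose proof (Cmod_ge_0 X). pose proof (Cmod_ge_0 Y). lra.
Qed.

Lemma cderiv_unique (f : C -> C) (z k l : C) : cderiv f z k -> cderiv f z l -> k = l.
Proof.
  intros [p [d [Hd [Hp [Hk H]]]]] [q [d' [Hd' [Hq [Hl H']]]]].
  apply Csub_eq. apply Cmod_eq_0. apply Rle_antisym; [|apply Cmod_ge_0].
  apply (le_of_le_plus_eps _ _ 2); [lra|]. intros eps He.
  destruct (Hp eps He) as [e [He1 Hpe]]. destruct (Hq eps He) as [e' [He1' Hqe]].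
  set (m := Rmin (Rmin d d') (Rmin e e')).
  assert (Hm : 0 < m) by (repeat apply Rmin_pos; lra).
  pose proof (Rmin_l (Rmin d d') (Rmin e e')) as M1.
  pose proof (Rmin_r (Rmin d d') (Rmin e e')) as M2. fold m in M1, M2.
  pose proof (Rmin_l d d'). pose proof (Rmin_r d d').
  pose proof (Rmin_l e e'). pose proof (Rmin_r e e').
  set (y := (z + RtoC (m / 2))%C).
  assert (Ey : (y - z)%C = RtoC (m / 2)) by (unfold y; ring).
  assert (Hy : Cmod (y - z) < m) by (rewrite Ey, Cmod_R, Rabs_pos_eq; lra).
  assert (Epq : p y = q y).
  { assert (Hne : RtoC (m / 2) <> 0) by (intro E; apply RtoC_inj in E; lra).
    assert (E : (p y * RtoC (m / 2))%C = (q y * RtoC (m / 2))%C).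
    { rewrite <- Ey. specialize (H y ltac:(lra)). specialize (H' y ltac:(lra)).
      replace (p y * (y - z))%C with (f y - f z)%C by (rewrite H; ring).
      rewrite H'. ring. }
    replace (p y) with (p y * RtoC (m / 2) * / RtoC (m / 2))%C by (field; auto).
    rewrite E. field. auto. }
  specialize (Hpe y ltac:(lra)). specialize (Hqe y ltac:(lra)).
  rewrite <- Hk, <- Hl.
  replace (p z - q z)%C with ((q y - q z) - (p y - p z))%C by (rewrite Epq; ring).
  pose proof (Cmod_sub_triangle (q y - q z) (p y - p z)). lra.
Qed.

(** Mean value theorem along the segment from 0 to [z], for the real part of the
    remainder turned onto the positive axis; the derivative [f1] is Lipschitz at 0. *)
Lemma quadratic_remainder (f : C -> C) (c : C) :
  hol2 (disk 1) f -> f 0 = 0 -> cderiv f 0 c ->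
  exists A d, 0 < d /\ forall z, Cmod z < d -> Cmod (f z - c * z) <= A * Cmod z ^ 2.
Proof.
  intros [f1 Hf] H0 Hc.
  assert (HD0 : disk 1 0) by (unfold disk; rewrite Cmod_0; lra).
  destruct (Hf 0 HD0) as [Hf10 [l [q [d [Hd [Hq [_ Hl]]]]]]].
  rewrite (cderiv_unique _ _ _ _ Hf10 Hc) in Hl.
  destruct (Hq 1 ltac:(lra)) as [d' [Hd' Hq']].
  exists (Cmod (q 0) + 1), (Rmin (Rmin d d') 1). split; [repeat apply Rmin_pos; lra|].
  intros z Hz. pose proof (Rmin_l (Rmin d d') 1). pose proof (Rmin_r (Rmin d d') 1).
  pose proof (Rmin_l d d'). pose proof (Rmin_r d d').
  destruct (unimodular_rotation (f z - c * z)) as [u [Hu HuX]].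
  set (k := fun y => (u * (f y + - c * y))%C).
  assert (Hlt : forall t, 0 <= t <= 1 -> Cmod (0 + t * z)%C <= Cmod z).
  { intros t Ht. replace (0 + t * z)%C with (t * z)%C by ring.
    rewrite Cmod_mult, Cmod_R, Rabs_pos_eq by lra. pose proof (Cmod_ge_0 z). nra. }
  assert (Hk : forall t, 0 <= t <= 1 ->
     is_derive (fun s : R => Re (k (0 + s * z)%C)) t
        (Re (u * (f1 (0 + t * z) - c) * z)%C)).
  { intros t Ht. apply (cderiv_along k 0 (u * (f1 (0 + t * z) - c))%C z t).
    unfold k.
    replace (u * (f1 (0 + t * z) - c))%C
     with (0 * (f (0 + t * z) + - c * (0 + t * z))
           + u * (f1 (0 + t * z) + (0 * (0 + t * z) + - c * 1)))%C by ring.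
    apply (cderiv_mult (fun _ => u) (fun y => f y + - c * y)%C); [apply cderiv_const|].
    apply (cderiv_plus f (fun y => - c * y)%C).
    - apply Hf. unfold disk. specialize (Hlt t Ht). lra.
    - apply (cderiv_mult (fun _ => (- c)%C) (fun y => y)); [apply cderiv_const|apply cderiv_id]. }
  destruct (MVT_cor2 (fun s : R => Re (k (0 + s * z)%C))
      (fun t => Re (u * (f1 (0 + t * z) - c) * z)%C) 0 1 Rlt_0_1) as [s [Hs1 Hs2]].
  { intros t Ht. apply is_derive_Reals. now apply Hk. }
  assert (E1 : k (0 + 1 * z)%C = RtoC (Cmod (f z - c * z))).
  { unfold k. rewrite <- HuX. replace (0 + 1 * z)%C with z by ring. ring. }
  assert (E0 : k (0 + 0 * z)%C = 0).
  { unfold k. replace (0 + 0 * z)%C with (RtoC 0) by ring. rewrite H0. ring. }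
  rewrite E1, E0, !re_RtoC in Hs1.
  pose proof (re_le_Cmod (u * (f1 (0 + s * z)%C - c) * z)) as Hre.
  pose proof (Rle_abs (Re (u * (f1 (0 + s * z)%C - c) * z))) as Hre'.
  rewrite !Cmod_mult, Hu in Hre.
  specialize (Hlt s ltac:(lra)).
  set (y := (0 + s * z)%C) in *.
  assert (Hf1 : Cmod (f1 y - c) <= (Cmod (q 0) + 1) * Cmod z).
  { rewrite Hl by (replace (y - 0)%C with y by ring; lra).
    replace (c + q y * (y - 0) - c)%C with (q y * y)%C by ring.
    rewrite Cmod_mult. specialize (Hq' y).
    replace (y - 0)%C with y in Hq' by ring. specialize (Hq' ltac:(lra)).
    pose proof (Cmod_sub_le (q y) (q 0)).
    apply Rmult_le_compat; try apply Cmod_ge_0; lra. }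
  pose proof (Cmod_ge_0 z). nra.
Qed.

(** Schwarz's lemma: the maximum principle for [f z / z], whose singularity at 0 is
    removable. *)
Lemma schwarz_quotient (f : C -> C) (M : R) :
  0 <= M -> hol2 (punctured 0) f ->
  (forall z, punctured 0 z -> Cmod (f z) <= M) ->
  (exists B d, 0 < d /\ forall z : C, z <> 0 -> Cmod z < d -> Cmod (f z) <= B * Cmod z) ->
  forall z, punctured 0 z -> Cmod (f z) <= M * Cmod z.
Proof.
  intros HM Hf Hb [B [d [Hd HB]]] z Hz.
  assert (HBn : bounded_near (fun y => f y * / y)%C 0).
  { exists B, d. split; auto. intros y Hy Hyd.
    replace (y - 0)%C with y in Hyd by ring.
    pose proof (proj1 (Cmod_gt_0 y) Hy).
    rewrite Cmod_mult, Cmod_inv by auto. apply Rle_div_l; auto. }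
  assert (H : Cmod (f z * / z) <= M).
  { apply (removable_max_principle (fun y => f y * / y)%C 0 M (2 * M) (1 / 2)); auto.
    - rewrite Cmod_0; lra.
    - lra.
    - apply hol2_mult; auto. apply hol2_inv; [apply hol2_id|]. intros y Hy. apply Hy.
    - intros y Hy Hy2. rewrite Cmod_mult, Cmod_inv by apply Hy.
      apply Rle_div_l; [lra|]. specialize (Hb y Hy). destruct Hy as [Hy1 _].
      assert (M * 1 <= M * ((1 + 2 * (1 - Cmod y)) * Cmod y)).
      { apply Rmult_le_compat_l; [lra|nra]. }
      lra. }
  destruct Hz as [_ [Hz _]]. pose proof (proj1 (Cmod_gt_0 z) Hz).
  rewrite Cmod_mult, Cmod_inv in H by auto.
  now apply Rle_div_l.
Qed.

Lemma Cmod_1_plus_ge (x : C) : 1 - Cmod x <= Cmod (1 + x)%C.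
Proof.
  pose proof (Cmod_sub_triangle (1 + x) x) as H.
  replace (1 + x - x)%C with (RtoC 1) in H by ring. rewrite Cmod_1 in H. lra.
Qed.

Lemma Cmod_1_minus_ge (x : C) : 1 - Cmod x <= Cmod (1 - x)%C.
Proof. rewrite <- (Cmod_opp x). apply Cmod_1_plus_ge. Qed.

(** The difference of the squares is [(1 - |a|^2) (1 - |b|^2)]. *)
Lemma mobius_le_1 (a b : C) :
  Cmod a <= 1 -> Cmod b <= 1 -> Cmod (a - b) <= Cmod (1 - Cconj b * a)%C.
Proof.
  intros Ha Hb. apply Rsqr_incr_0_var; [|apply Cmod_ge_0]. rewrite !Rsqr_pow2.
  assert (E : Cmod (1 - Cconj b * a)%C ^ 2 - Cmod (a - b) ^ 2
              = (1 - Cmod a ^ 2) * (1 - Cmod b ^ 2)).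
  { rewrite !Cmod2_alt. destruct a as [a1 a2], b as [b1 b2]. simpl. ring. }
  pose proof (Cmod_ge_0 a). pose proof (Cmod_ge_0 b).
  assert (0 <= (1 - Cmod a ^ 2) * (1 - Cmod b ^ 2)) by (apply Rmult_le_pos; nra).
  lra.
Qed.

(** Both Moebius quotients [(T z - T w) / (1 - conj (T w) T z)] and
    [(z - w) / (1 - conj w z)] have modulus at most 1, and the second tends to 1 at the
    boundary; so the maximum principle bounds the ratio of the first to the second
    by 1. *)
Lemma schwarz_pick (T : C -> C) (w z : C) :
  hol2 (punctured 0) T -> (forall y, punctured 0 y -> Cmod (T y) <= Cmod y) ->
  punctured 0 w -> punctured w z ->
  Cmod (T z - T w) * Cmod (1 - Cconj w * z)%C
  <= Cmod (z - w) * Cmod (1 - Cconj (T w) * T z)%C.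
Proof.
  intros HT HTb Hw Hz.
  assert (Hsub : forall y, punctured w y -> punctured 0 y)
    by (intros y [H1 [H2 _]]; repeat split; auto).
  assert (HTw : Cmod (T w) <= Cmod w) by auto.
  assert (Hw1 : Cmod w < 1) by apply Hw.
  assert (Hw0 : 0 < Cmod w) by (apply Cmod_gt_0, Hw).
  assert (Hden : forall y, punctured w y -> 1 - Cmod w <= Cmod (1 - Cconj (T w) * T y)%C).
  { intros y Hy. pose proof (Cmod_1_minus_ge (Cconj (T w) * T y)) as H.
    rewrite Cmod_mult, Cmod_conj in H. specialize (HTb y (Hsub y Hy)).
    destruct Hy as [Hy _]. pose proof (Cmod_ge_0 (T y)). pose proof (Cmod_ge_0 (T w)). nra. }
  assert (Hnz : forall y, punctured w y ->
     (1 - Cconj (T w) * T y)%C <> 0 /\ (y - w)%C <> 0 /\ 0 < Cmod (y - w)).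
  { intros y Hy. specialize (Hden y Hy). split; [apply Cmod_gt_0; lra|].
    assert (y - w <> 0)%C. { intro E. apply Hy. now apply Csub_eq. }
    split; auto. now apply Cmod_gt_0. }
  set (Q := fun y : C => ((T y + - T w) * (1 + - Cconj w * y)
               * (/ (y + - w) * / (1 + - Cconj (T w) * T y)))%C).
  assert (HQm : forall y, punctured w y -> Cmod (Q y)
    = Cmod (T y - T w) * Cmod (1 - Cconj w * y)%C
      / (Cmod (y - w) * Cmod (1 - Cconj (T w) * T y)%C)).
  { intros y Hy. destruct (Hnz y Hy) as [H1 [H2 _]]. unfold Q.
    replace (1 + - Cconj (T w) * T y)%C with (1 - Cconj (T w) * T y)%C by ring.
    replace (1 + - Cconj w * y)%C with (1 - Cconj w * y)%C by ring.
    rewrite !Cmod_mult, !Cmod_inv by auto.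
    change (y + - w)%C with (y - w)%C. change (T y + - T w)%C with (T y - T w)%C.
    rewrite <- Rinv_mult. reflexivity. }
  assert (Hnum : forall y, Cmod y < 1 -> Cmod (1 - Cconj w * y)%C <= 2).
  { intros y Hy. pose proof (Cmod_sub_triangle 1 (Cconj w * y)) as H.
    rewrite Cmod_1, Cmod_mult, Cmod_conj in H. pose proof (Cmod_ge_0 y). nra. }
  enough (H : Cmod (Q z) <= 1).
  { rewrite HQm in H by auto. destruct (Hnz z Hz) as [H1 [_ H2]].
    apply Cmod_gt_0 in H1. apply Rle_div_l in H; [|nra]. lra. }
  apply (removable_max_principle Q w 1 (4 / (1 - Cmod w)) ((1 + Cmod w) / 2)); auto; try lra.
  - unfold Q. repeat apply hol2_mult.
    + apply hol2_plus; [|apply hol2_const]. now apply (hol2_sub _ (punctured 0)).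
    + apply hol2_plus; [apply hol2_const|]. apply hol2_mult; [apply hol2_const|apply hol2_id].
    + apply (hol2_inv _ (fun y => y + - w)%C).
      * apply hol2_plus; [apply hol2_id|apply hol2_const].
      * intros y Hy. now apply Hnz.
    + apply (hol2_inv _ (fun y => 1 + - Cconj (T w) * T y)%C).
      * apply hol2_plus; [apply hol2_const|]. apply hol2_mult; [apply hol2_const|].
        now apply (hol2_sub _ (punctured 0)).
      * intros y Hy E. apply (proj1 (Hnz y Hy)). rewrite <- E. ring.
  - exists (2 * 2 / (Cmod w / 2 * (1 - Cmod w))), (Rmin (Cmod w / 2) 1).
    split; [apply Rmin_pos; lra|]. intros y Hy Hyd.
    replace (y - 0)%C with y in Hyd by ring.
    pose proof (Rmin_l (Cmod w / 2) 1). pose proof (Rmin_r (Cmod w / 2) 1).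
    assert (Hyw : punctured w y).
    { repeat split; auto; [lra|]. intros ->. lra. }
    rewrite HQm by auto. specialize (Hden y Hyw).
    pose proof (Cmod_sub_le w y) as Hs. rewrite Cmod_minus_sym in Hs.
    apply Rmult_le_compat.
    + apply Rmult_le_pos; apply Cmod_ge_0.
    + apply Rlt_le, Rinv_0_lt_compat, Rmult_lt_0_compat; lra.
    + apply Rmult_le_compat; try apply Cmod_ge_0; [|apply Hnum; lra].
      pose proof (Cmod_sub_triangle (T y) (T w)). specialize (HTb y (Hsub y Hyw)). lra.
    + apply Rinv_le_contravar; [apply Rmult_lt_0_compat; lra|].
      apply Rmult_le_compat; lra.
  - destruct HT as [T1 HT1]. destruct (HT1 w Hw) as [[q [d [Hd [Hq [_ Hqe]]]]] _].
    destruct (Hq 1 ltac:(lra)) as [d' [Hd' Hq']].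
    exists ((Cmod (q w) + 1) * 2 / (1 - Cmod w)), (Rmin (Rmin d d') (Rmin (Cmod w) (1 - Cmod w))).
    split; [repeat apply Rmin_pos; lra|]. intros y Hy Hyd.
    pose proof (Rmin_l (Rmin d d') (Rmin (Cmod w) (1 - Cmod w))).
    pose proof (Rmin_r (Rmin d d') (Rmin (Cmod w) (1 - Cmod w))).
    pose proof (Rmin_l d d'). pose proof (Rmin_r d d').
    pose proof (Rmin_l (Cmod w) (1 - Cmod w)). pose proof (Rmin_r (Cmod w) (1 - Cmod w)).
    assert (Hyw : punctured w y).
    { repeat split; auto.
      - pose proof (Cmod_sub_le y w). lra.
      - intros ->. rewrite Cmod_minus_sym in Hyd. replace (w - 0)%C with w in Hyd by ring.
        lra. }
    destruct (Hnz y Hyw) as [_ [_ Hyw0]]. specialize (Hden y Hyw).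
    rewrite HQm by auto.
    replace (T y - T w)%C with (q y * (y - w))%C by (rewrite (Hqe y) by lra; ring).
    rewrite Cmod_mult.
    replace (Cmod (q y) * Cmod (y - w) * Cmod (1 - Cconj w * y)%C
       / (Cmod (y - w) * Cmod (1 - Cconj (T w) * T y)%C))
     with (Cmod (q y) * Cmod (1 - Cconj w * y)%C / Cmod (1 - Cconj (T w) * T y)%C)
     by (field; lra).
    apply Rmult_le_compat.
    + apply Rmult_le_pos; apply Cmod_ge_0.
    + apply Rlt_le, Rinv_0_lt_compat; lra.
    + apply Rmult_le_compat; try apply Cmod_ge_0; [|apply Hnum, Hyw].
      specialize (Hq' y ltac:(lra)). pose proof (Cmod_sub_le (q y) (q w)). lra.
    + apply Rinv_le_contravar; lra.
  - intros y Hy Hyr. rewrite HQm by auto. destruct (Hnz y Hy) as [H1 [H2 H3]].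
    pose proof (HTb y (Hsub y Hy)) as HTy. destruct (Hy) as [Hy1 _].
    assert (Hm := mobius_le_1 (T y) (T w) ltac:(lra) ltac:(lra)).
    apply Cmod_gt_0 in H1.
    (* 1 - conj w y = (1 - |y|^2) + y conj (y - w), and |y| < 1 *)
    assert (Hnum' : Cmod (1 - Cconj w * y)%C <= (1 - Cmod y ^ 2) + Cmod (y - w)).
    { replace (1 - Cconj w * y)%C with (RtoC (1 - Cmod y ^ 2) + y * Cconj (y - w))%C
        by (rewrite RtoC_minus, Cmod2_conj, Cminus_conj; ring).
      eapply Rle_trans; [apply Cmod_triangle|].
      rewrite Cmod_mult, Cmod_conj, Cmod_R, Rabs_pos_eq
        by (pose proof (Cmod_ge_0 y); nra).
      pose proof (Cmod_ge_0 (y - w)). pose proof (Cmod_ge_0 y). nra. }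
    pose proof (Cmod_sub_le y w) as Hs.
    apply Rle_div_l; [nra|].
    set (D := Cmod (1 - Cconj (T w) * T y)%C) in *.
    assert (Hkey : Cmod (1 - Cconj w * y)%C
        <= (1 + 4 / (1 - Cmod w) * (1 - Cmod y)) * Cmod (y - w)).
    { assert (4 / (1 - Cmod w) * ((1 - Cmod w) / 2) = 2) by (field; lra).
      assert (0 < 4 / (1 - Cmod w)) by (apply Rdiv_lt_0_compat; lra).
      assert (2 <= 4 / (1 - Cmod w) * Cmod (y - w)).
      { replace 2 with (4 / (1 - Cmod w) * ((1 - Cmod w) / 2)) at 1.
        apply Rmult_le_compat_l; lra. }
      pose proof (Cmod_ge_0 y).
      assert ((1 - Cmod y) * 2 <= (1 - Cmod y) * (4 / (1 - Cmod w) * Cmod (y - w)))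
        by (apply Rmult_le_compat_l; lra).
      nra. }
    pose proof (Cmod_ge_0 (T y - T w)). pose proof (Cmod_ge_0 (1 - Cconj w * y)).
    apply Rle_trans with (D * ((1 + 4 / (1 - Cmod w) * (1 - Cmod y)) * Cmod (y - w))).
    + apply Rmult_le_compat; auto.
    + lra.
Qed.

(** With [X = conj c a], [Y = conj c b] and [s = |c| R0] the identity
    [2 (1 - conj Y X) = (1 + conj Y) (1 - X) + (1 - conj Y) (1 + X)] gives the
    inequality for [|c| = 1], with [s] for [R0]; the defect
    [(1 - |c|^2) conj b a] is absorbed by the passage from [s] to [R0]. *)
Lemma denominators_ineq (a b c : C) (R0 : R) :
  Cmod c <= 1 -> R0 < 1 -> Cmod a <= R0 -> Cmod b <= R0 ->
  Cmod (1 - Cconj b * a)%C * (1 - R0)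
  <= (1 + R0) * (Cmod (1 + Cconj c * a)%C * Cmod (1 + Cconj c * b)%C).
Proof.
  intros Hc HR Ha Hb.
  set (h := Cmod c) in *. pose proof (Cmod_ge_0 c) as Hh. fold h in Hh.
  pose proof (Cmod_ge_0 a). pose proof (Cmod_ge_0 b).
  set (X := (Cconj c * a)%C). set (Y := (Cconj c * b)%C).
  set (s := h * R0). assert (Hs0 : 0 <= s) by (unfold s; nra).
  assert (Hs1 : s <= R0) by (unfold s; nra).
  assert (HX : Cmod X <= s).
  { unfold X, s. rewrite Cmod_mult, Cmod_conj. fold h. nra. }
  assert (HY : Cmod Y <= s).
  { unfold Y, s. rewrite Cmod_mult, Cmod_conj. fold h. nra. }
  pose proof (Cmod_1_plus_ge X) as HX1. pose proof (Cmod_1_plus_ge Y) as HY1.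
  pose proof (Cmod_sub_triangle 1 X) as HX2. pose proof (Cmod_sub_triangle 1 Y) as HY2.
  rewrite Cmod_1 in HX2, HY2.
  assert (HYp : Cmod (1 + Cconj Y)%C = Cmod (1 + Y)%C).
  { rewrite <- (Cmod_conj (1 + Y)), Cplus_conj. do 2 f_equal.
    apply injective_projections; simpl; ring. }
  assert (HYm : Cmod (1 - Cconj Y)%C = Cmod (1 - Y)%C).
  { rewrite <- (Cmod_conj (1 - Y)), Cminus_conj. do 2 f_equal.
    apply injective_projections; simpl; ring. }
  set (P := Cmod (1 + X)%C * Cmod (1 + Y)%C).
  assert (H1 : Cmod (1 - Cconj Y * X)%C * (1 - s) <= (1 + s) * P).
  { assert (E : (2 * (1 - Cconj Y * X))%C
       = ((1 + Cconj Y) * (1 - X) + (1 - Cconj Y) * (1 + X))%C) by ring.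
    pose proof (Cmod_triangle ((1 + Cconj Y) * (1 - X)) ((1 - Cconj Y) * (1 + X))) as Ht.
    rewrite <- E, !Cmod_mult, HYp, HYm, Cmod_R, Rabs_pos_eq in Ht by lra.
    assert (Cmod (1 - X)%C * (1 - s) <= (1 + s) * Cmod (1 + X)%C).
    { apply Rle_trans with ((1 + s) * (1 - s));
        [apply Rmult_le_compat_r|apply Rmult_le_compat_l]; lra. }
    assert (Cmod (1 - Y)%C * (1 - s) <= (1 + s) * Cmod (1 + Y)%C).
    { apply Rle_trans with ((1 + s) * (1 - s));
        [apply Rmult_le_compat_r|apply Rmult_le_compat_l]; lra. }
    pose proof (Cmod_ge_0 (1 + X)). pose proof (Cmod_ge_0 (1 + Y)).
    unfold P. nra. }
  assert (H2 : Cmod (1 - Cconj b * a)%C <= Cmod (1 - Cconj Y * X)%C + (1 - h ^ 2) * R0 ^ 2).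
  { replace (1 - Cconj b * a)%C
      with ((1 - Cconj Y * X) - RtoC (1 - h ^ 2) * (Cconj b * a))%C.
    - eapply Rle_trans; [apply Cmod_sub_triangle|]. apply Rplus_le_compat_l.
      rewrite !Cmod_mult, Cmod_conj, Cmod_R, Rabs_pos_eq by nra.
      apply Rmult_le_compat_l; nra.
    - unfold X, Y, h. rewrite Cmult_conj, Cconj_conj, RtoC_minus, Cmod2_conj. ring. }
  assert (HP : (1 - s) ^ 2 <= P).
  { unfold P. simpl. rewrite Rmult_1_r. apply Rmult_le_compat; lra. }
  assert (H3 : (1 - R0) * ((1 - h ^ 2) * R0 ^ 2) * (1 - s) <= 2 * (R0 - s) * P).
  { apply Rle_trans with (2 * (R0 - s) * (1 - s) ^ 2);
      [|apply Rmult_le_compat_l; lra].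
    replace (R0 - s) with (R0 * (1 - h)) by (unfold s; ring).
    replace ((1 - R0) * ((1 - h ^ 2) * R0 ^ 2) * (1 - s))
      with (R0 * (1 - h) * (1 - s) * ((1 + h) * R0 * (1 - R0))) by ring.
    replace (2 * (R0 * (1 - h)) * (1 - s) ^ 2)
      with (R0 * (1 - h) * (1 - s) * (2 * (1 - s))) by ring.
    apply Rmult_le_compat_l; [repeat apply Rmult_le_pos; lra|].
    apply Rle_trans with (2 * (1 - R0)); [|lra].
    apply Rmult_le_compat_r; nra. }
  apply (Rmult_le_reg_r (1 - s)); [lra|].
  assert (Cmod (1 - Cconj b * a)%C * (1 - R0) * (1 - s)
    <= (Cmod (1 - Cconj Y * X)%C + (1 - h ^ 2) * R0 ^ 2) * (1 - R0) * (1 - s)).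
  { apply Rmult_le_compat_r; [lra|]. apply Rmult_le_compat_r; lra. }
  assert ((1 - R0) * (Cmod (1 - Cconj Y * X)%C * (1 - s)) <= (1 - R0) * ((1 + s) * P)).
  { apply Rmult_le_compat_l; lra. }
  nra.
Qed.

(** * Estimates for bounded analytic functions *)

Lemma cderiv_at_0_bound (f : C -> C) (c : C) (B d : R) :
  cderiv f 0 c -> f 0 = 0 -> 0 < d ->
  (forall z : C, z <> 0 -> Cmod z < d -> Cmod (f z) <= B * Cmod z) -> Cmod c <= B.
Proof.
  intros [q [d1 [Hd1 [Hq [Hc H]]]]] H0 Hd Hb.
  apply (le_of_le_plus_eps _ _ 1); [lra|]. intros eps He.
  destruct (Hq eps He) as [d2 [Hd2 Hq2]].
  set (m := Rmin d (Rmin d1 d2)).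
  assert (Hm : 0 < m) by (repeat apply Rmin_pos; lra).
  assert (m <= d) by apply Rmin_l. assert (m <= Rmin d1 d2) by apply Rmin_r.
  pose proof (Rmin_l d1 d2). pose proof (Rmin_r d1 d2).
  set (y := RtoC (m / 2)).
  assert (Ey : Cmod y = m / 2) by (unfold y; rewrite Cmod_R, Rabs_pos_eq; lra).
  assert (Hy0 : y <> 0) by (apply Cmod_gt_0; lra).
  specialize (Hb y Hy0 ltac:(lra)).
  assert (Ey0 : (y - 0)%C = y) by ring.
  specialize (H y). specialize (Hq2 y). rewrite Ey0 in *.
  rewrite H, H0 in Hb by lra. replace (0 + q y * y)%C with (q y * y)%C in Hb by ring.
  rewrite Cmod_mult in Hb. apply Rmult_le_reg_r in Hb; [|lra].
  specialize (Hq2 ltac:(lra)). rewrite Hc, Cmod_minus_sym in Hq2.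
  pose proof (Cmod_sub_le c (q y)). lra.
Qed.

(** Let [H = h / z] and [T = (H - c) / (1 - conj c H)].  Schwarz's lemma gives
    [|T z| <= |z|], and then
    [H - c = (1 - |c|^2) T / (1 + conj c T)] gives the first estimate.  For the second,
    [H z - H w = (1 - |c|^2) (T z - T w) / ((1 + conj c T z) (1 + conj c T w))]; the
    Schwarz-Pick lemma bounds [T z - T w], and the denominators that remain are those
    of [denominators_ineq]. *)
Lemma schwarz_pick_estimates (h : C -> C) (c : C) (kappa : R) :
  hol2 (disk 1) h -> h 0 = 0 -> cderiv h 0 c -> 0 <= kappa < 1 ->
  (forall z, punctured 0 z -> Cmod (h z) <= kappa * Cmod z) ->
  (forall z, punctured 0 z ->
     Cmod (h z / z - c)%C * (1 - Cmod z) <= (1 - Cmod c ^ 2) * Cmod z) /\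
  (forall z w r, r < 1 -> punctured 0 z -> punctured 0 w -> Cmod z <= r -> Cmod w <= r ->
     Cmod (h z / z - h w / w)%C * (1 - r) ^ 2 <= (1 - Cmod c ^ 2) * Cmod (z - w)).
Proof.
  intros Hh H0 Hc Hk Hb.
  assert (Hck : Cmod c <= kappa).
  { apply (cderiv_at_0_bound h c kappa 1); auto; [lra|].
    intros z Hz Hz1. apply Hb. repeat split; auto. }
  pose proof (Cmod_ge_0 c) as Hc0.
  assert (Hc2 : 0 <= 1 - Cmod c ^ 2) by nra.
  assert (Hsub : forall z, punctured 0 z -> disk 1 z) by (intros z Hz; apply Hz).
  set (H := fun z : C => (h z * / z)%C).
  assert (HH : hol2 (punctured 0) H).
  { apply hol2_mult; [now apply (hol2_sub _ (disk 1))|].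
    apply hol2_inv; [apply hol2_id|]. intros z Hz; apply Hz. }
  assert (HHb : forall z, punctured 0 z -> Cmod (H z) <= kappa).
  { intros z Hz. unfold H. destruct (Hz) as [_ [Hz0 _]].
    pose proof (proj1 (Cmod_gt_0 z) Hz0).
    rewrite Cmod_mult, Cmod_inv by auto. apply Rle_div_l; auto. }
  assert (Hden : forall z, punctured 0 z -> 1 - kappa <= Cmod (1 + - Cconj c * H z)%C).
  { intros z Hz. pose proof (Cmod_1_plus_ge (- Cconj c * H z)) as E.
    rewrite Cmod_mult, Cmod_opp, Cmod_conj in E. specialize (HHb z Hz).
    pose proof (Cmod_ge_0 (H z)). nra. }
  assert (Hnz : forall z, punctured 0 z -> (1 + - Cconj c * H z)%C <> 0).
  { intros z Hz. apply Cmod_gt_0. specialize (Hden z Hz). lra. }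
  set (T := fun z : C => ((H z + - c) * / (1 + - Cconj c * H z))%C).
  assert (HT : hol2 (punctured 0) T).
  { apply hol2_mult.
    - apply hol2_plus; auto using hol2_const.
    - apply (hol2_inv _ (fun z => 1 + - Cconj c * H z)%C); auto.
      apply hol2_plus; [apply hol2_const|]. apply hol2_mult; auto using hol2_const. }
  assert (HTb : forall z, punctured 0 z -> Cmod (T z) <= 1 * Cmod z).
  { apply schwarz_quotient; auto; [lra| |].
    - intros z Hz. unfold T. rewrite Cmod_mult, Cmod_inv by auto.
      apply Rle_div_l; [specialize (Hden z Hz); lra|]. rewrite Rmult_1_l.
      replace (1 + - Cconj c * H z)%C with (1 - Cconj c * H z)%C by ring.
      apply mobius_le_1; [specialize (HHb z Hz)|]; lra.
    - destruct (quadratic_remainder h c Hh H0 Hc) as [A [d [Hd HA]]].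
      exists (A / (1 - kappa)), (Rmin d 1). split; [apply Rmin_pos; lra|].
      intros z Hz0 Hz. pose proof (Rmin_l d 1). pose proof (Rmin_r d 1).
      assert (Hp : punctured 0 z) by (repeat split; auto; lra).
      specialize (HA z ltac:(lra)). specialize (Hden z Hp).
      pose proof (proj1 (Cmod_gt_0 z) Hz0).
      unfold T. rewrite Cmod_mult, Cmod_inv by auto.
      assert (HHc : Cmod (H z + - c)%C <= A * Cmod z).
      { replace (H z + - c)%C with ((h z - c * z) * / z)%C by (unfold H; field; auto).
        rewrite Cmod_mult, Cmod_inv by auto. apply Rle_div_l; [lra|].
        simpl in HA. lra. }
      replace (A / (1 - kappa) * Cmod z) with (A * Cmod z * / (1 - kappa)) by (field; lra).
      apply Rmult_le_compat; auto using Cmod_ge_0.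
      + apply Rlt_le, Rinv_0_lt_compat. lra.
      + apply Rinv_le_contravar; lra. }
  assert (HTb' : forall z, punctured 0 z -> Cmod (T z) <= Cmod z).
  { intros z Hz. rewrite <- (Rmult_1_l (Cmod z)). auto. }
  (* H = (T + c) / (1 + conj c T): the Moebius map taking H to T, inverted *)
  assert (Hinv : forall z, punctured 0 z ->
     ((H z - c) * (1 + Cconj c * T z))%C = (RtoC (1 - Cmod c ^ 2) * T z)%C).
  { intros z Hz. specialize (Hnz z Hz). unfold T. rewrite RtoC_minus, Cmod2_conj.
    field. replace (1 - Cconj c * H z)%C with (1 + - Cconj c * H z)%C by ring. exact Hnz. }
  assert (HD : forall z, punctured 0 z -> 1 - Cmod z <= Cmod (1 + Cconj c * T z)%C).
  { intros z Hz. pose proof (Cmod_1_plus_ge (Cconj c * T z)) as E.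
    rewrite Cmod_mult, Cmod_conj in E. specialize (HTb' z Hz).
    pose proof (Cmod_ge_0 (T z)). nra. }
  split.
  - intros z Hz. change (h z / z)%C with (H z).
    pose proof (f_equal Cmod (Hinv z Hz)) as E.
    rewrite !Cmod_mult, Cmod_R, Rabs_pos_eq in E by auto.
    apply Rle_trans with (Cmod (H z - c) * Cmod (1 + Cconj c * T z)%C).
    + apply Rmult_le_compat_l; auto using Cmod_ge_0.
    + rewrite E. apply Rmult_le_compat_l; auto.
  - intros z w r Hr Hz Hw Hzr Hwr. change (h z / z)%C with (H z). change (h w / w)%C with (H w).
    destruct (classic (z = w)) as [->|Hne].
    { rewrite !Cmod_self_minus. lra. }
    assert (Hzw : punctured w z) by (destruct Hz as [? [? ?]]; repeat split; auto).
    pose proof (schwarz_pick T w z HT HTb' Hw Hzw) as HSP.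
    pose proof (denominators_ineq (T z) (T w) c r ltac:(lra) Hr
      ltac:(specialize (HTb' z Hz); lra) ltac:(specialize (HTb' w Hw); lra)) as HDI.
    assert (E : ((H z - H w) * ((1 + Cconj c * T z) * (1 + Cconj c * T w)))%C
               = (RtoC (1 - Cmod c ^ 2) * (T z - T w))%C).
    { replace ((H z - H w) * ((1 + Cconj c * T z) * (1 + Cconj c * T w)))%C
        with ((H z - c) * (1 + Cconj c * T z) * (1 + Cconj c * T w)
            - (H w - c) * (1 + Cconj c * T w) * (1 + Cconj c * T z))%C by ring.
      rewrite !Hinv by auto. ring. }
    pose proof (f_equal Cmod E) as EM. clear E.
    rewrite !Cmod_mult, Cmod_R, Rabs_pos_eq in EM by auto.
    pose proof (HD z Hz). pose proof (HD w Hw).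
    destruct Hz as [Hz1 _]. destruct Hw as [Hw1 _].
    set (P := Cmod (1 + Cconj c * T z)%C * Cmod (1 + Cconj c * T w)%C) in *.
    assert (HP : 0 < P) by (apply Rmult_lt_0_compat; lra).
    pose proof (Cmod_ge_0 z). pose proof (Cmod_ge_0 w).
    assert (Hwz : 1 - r ^ 2 <= Cmod (1 - Cconj w * z)%C).
    { pose proof (Cmod_1_minus_ge (Cconj w * z)) as E. rewrite Cmod_mult, Cmod_conj in E.
      nra. }
    set (X := Cmod (H z - H w)) in *. set (t := Cmod (T z - T w)) in *.
    set (V := Cmod (1 - Cconj (T w) * T z)%C) in *. set (m := Cmod (z - w)) in *.
    assert (0 <= t) by apply Cmod_ge_0. assert (0 <= m) by apply Cmod_ge_0.
    assert (S1 : t * (1 - r ^ 2) <= m * V).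
    { eapply Rle_trans; [apply Rmult_le_compat_l|]; eauto. }
    assert (S2 : m * (V * (1 - r)) <= m * ((1 + r) * P)) by (apply Rmult_le_compat_l; auto).
    assert (S3 : t * (1 - r ^ 2) * (1 - r) <= m * V * (1 - r))
      by (apply Rmult_le_compat_r; lra).
    assert (S4 : t * (1 - r) ^ 2 <= m * P).
    { apply (Rmult_le_reg_r (1 + r)); [lra|]. lra. }
    apply (Rmult_le_reg_r P); auto.
    replace (X * (1 - r) ^ 2 * P) with (X * P * (1 - r) ^ 2) by ring.
    rewrite EM. rewrite !Rmult_assoc. apply Rmult_le_compat_l; auto.
Qed.

Lemma minus_inv_ge_0 (M : R) : 1 <= M -> 0 <= M - 1 / M.
Proof.
  intro HM.
  assert (/ M <= 1) by (rewrite <- Rinv_1; apply Rinv_le_contravar; lra). lra.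
Qed.

(** In terms of coefficients, [f z / z - c] is dominated by the series
    [(M - 1 / M) (z + z^2 + ...)]: the two bounds are those that
    [|a_n| <= M - 1 / M] for [n >= 2] would give. *)
Lemma bounded_function_estimates (f : C -> C) (c : C) (M : R) :
  hol2 (disk 1) f -> f 0 = 0 -> cderiv f 0 c -> 1 <= Cmod c ->
  (forall z, disk 1 z -> Cmod (f z) <= M) ->
  1 <= M /\
  (forall z, punctured 0 z ->
     Cmod (f z / z - c)%C * (1 - Cmod z) <= (M - 1 / M) * Cmod z) /\
  (forall z w r, r < 1 -> punctured 0 z -> punctured 0 w -> Cmod z <= r -> Cmod w <= r ->
     Cmod (f z / z - f w / w)%C * (1 - r) ^ 2 <= (M - 1 / M) * Cmod (z - w)).
Proof.
  intros Hf H0 Hc Hc1 HM.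
  assert (HM0 : 0 <= M).
  { specialize (HM 0). rewrite H0, Cmod_0 in HM. apply HM. unfold disk. rewrite Cmod_0. lra. }
  assert (HS : forall z, punctured 0 z -> Cmod (f z) <= M * Cmod z).
  { apply schwarz_quotient; auto.
    - apply (hol2_sub _ (disk 1)); auto. intros z Hz; apply Hz.
    - intros z Hz. apply HM, Hz.
    - destruct Hc as [q [d [Hd [Hq [_ Hqe]]]]]. destruct (Hq 1 ltac:(lra)) as [d' [Hd' Hq']].
      exists (Cmod (q 0) + 1), (Rmin d d'). split; [now apply Rmin_pos|].
      intros z _ Hz. pose proof (Rmin_l d d'). pose proof (Rmin_r d d').
      specialize (Hqe z). specialize (Hq' z).
      replace (z - 0)%C with z in * by ring. specialize (Hq' ltac:(lra)).
      rewrite Hqe, H0 by lra. replace (0 + q z * z)%C with (q z * z)%C by ring.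
      rewrite Cmod_mult. apply Rmult_le_compat_r; [apply Cmod_ge_0|].
      pose proof (Cmod_sub_le (q z) (q 0)). lra. }
  assert (HM1 : 1 <= M).
  { apply Rle_trans with (Cmod c); auto. apply (cderiv_at_0_bound f c M 1); auto; [lra|].
    intros z Hz Hz1. apply HS. repeat split; auto. }
  split; auto.
  (* The Moebius step needs a bound below 1, so f is divided by N > M and N tends to M. *)
  assert (HN : forall eps, 0 < eps ->
    (forall z, punctured 0 z ->
       Cmod (f z / z - c)%C * (1 - Cmod z) <= (M - 1 / M + 2 * eps) * Cmod z) /\
    (forall z w r, r < 1 -> punctured 0 z -> punctured 0 w -> Cmod z <= r -> Cmod w <= r ->
       Cmod (f z / z - f w / w)%C * (1 - r) ^ 2 <= (M - 1 / M + 2 * eps) * Cmod (z - w))).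
  { intros eps He. set (N := M + eps).
    assert (HNp : 0 < N) by (unfold N; lra).
    assert (HNc : RtoC N <> 0) by (intro E; apply RtoC_inj in E; lra).
    assert (HNm : Cmod (/ N)%C = / N).
    { rewrite Cmod_inv, Cmod_R, Rabs_pos_eq by (auto; lra). reflexivity. }
    destruct (schwarz_pick_estimates (fun z => / N * f z)%C (/ N * c)%C (M / N))
      as [E1 E2].
    - apply hol2_mult; auto using hol2_const.
    - rewrite H0. ring.
    - replace (/ N * c)%C with (0 * f 0 + / N * c)%C by ring.
      apply (cderiv_mult (fun _ => (/ N)%C) f); auto using cderiv_const.
    - split; [apply Rmult_le_pos; [lra|apply Rlt_le, Rinv_0_lt_compat; lra]|].
      apply Rlt_div_l; unfold N; lra.
    - intros z Hz. rewrite Cmod_mult, HNm. specialize (HS z Hz).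
      replace (M / N * Cmod z) with (/ N * (M * Cmod z)) by (field; lra).
      apply Rmult_le_compat_l; auto. apply Rlt_le, Rinv_0_lt_compat; lra.
    - assert (HK : N * (1 - Cmod (/ N * c)%C ^ 2) <= M - 1 / M + 2 * eps).
      { rewrite Cmod_mult, HNm.
        replace (N * (1 - (/ N * Cmod c) ^ 2)) with (N - Cmod c ^ 2 * / N) by (field; lra).
        assert (1 * / N <= Cmod c ^ 2 * / N).
        { apply Rmult_le_compat_r; [apply Rlt_le, Rinv_0_lt_compat; lra|]. nra. }
        assert (1 / M - / N <= eps).
        { unfold N. replace (1 / M - / (M + eps)) with (eps * / (M * (M + eps)))
            by (field; lra).
          rewrite <- (Rmult_1_r eps) at 3. apply Rmult_le_compat_l; [lra|].
          rewrite <- Rinv_1. apply Rinv_le_contravar; nra. }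
        unfold N in *. lra. }
      split.
      + intros z Hz. specialize (E1 z Hz). destruct (Hz) as [_ [Hz0 _]].
        replace (/ N * f z / z - / N * c)%C with (/ N * (f z / z - c))%C in E1
          by (field; auto).
        rewrite (Cmod_mult (/ N) (f z / z - c)), HNm in E1.
        apply (Rmult_le_compat_l N) in E1; [|lra].
        replace (N * (/ N * Cmod (f z / z - c) * (1 - Cmod z)))
          with (Cmod (f z / z - c) * (1 - Cmod z)) in E1 by (field; lra).
        eapply Rle_trans; [exact E1|]. rewrite <- Rmult_assoc.
        apply Rmult_le_compat_r; auto using Cmod_ge_0.
      + intros z w r Hr Hz Hw Hzr Hwr. specialize (E2 z w r Hr Hz Hw Hzr Hwr).
        destruct (Hz) as [_ [Hz0 _]]. destruct (Hw) as [_ [Hw0 _]].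
        replace (/ N * f z / z - / N * f w / w)%C with (/ N * (f z / z - f w / w))%C in E2
          by (field; auto).
        rewrite (Cmod_mult (/ N) (f z / z - f w / w)), HNm in E2.
        apply (Rmult_le_compat_l N) in E2; [|lra].
        replace (N * (/ N * Cmod (f z / z - f w / w) * (1 - r) ^ 2))
          with (Cmod (f z / z - f w / w) * (1 - r) ^ 2) in E2 by (field; lra).
        eapply Rle_trans; [exact E2|]. rewrite <- Rmult_assoc.
        apply Rmult_le_compat_r; auto using Cmod_ge_0. }
  split.
  - intros z Hz. apply (le_of_le_plus_eps _ _ (2 * Cmod z)).
    + pose proof (Cmod_ge_0 z). lra.
    + intros eps He. pose proof (proj1 (HN eps He) z Hz). lra.
  - intros z w r Hr Hz Hw Hzr Hwr. apply (le_of_le_plus_eps _ _ (2 * Cmod (z - w))).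
    + pose proof (Cmod_ge_0 (z - w)). lra.
    + intros eps He. pose proof (proj2 (HN eps He) z w r Hr Hz Hw Hzr Hwr). lra.
Qed.

(** In the variable [radial_cube z] the leading part of [|z|^2 g] is real-linear. *)
Definition radial_cube (z : C) : C := (RtoC (Cmod z ^ 2) * z)%C.

(** With [s = |z|^2 >= t = |w|^2] the difference is [t (z - w) + (s - t) z], and
    [z - w] has nonnegative inner product with [z]. *)
Lemma radial_cube_expansion (z w : C) : Cmod w <= Cmod z ->
  Cmod w ^ 2 * Cmod (z - w) <= Cmod (radial_cube z - radial_cube w).
Proof.
  intro H. apply Rsqr_incr_0_var; [|apply Cmod_ge_0]. rewrite !Rsqr_pow2.
  pose proof (Cmod_ge_0 w) as Hw0.
  rewrite Rpow_mult_distr.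
  set (s := Cmod z ^ 2). set (t := Cmod w ^ 2).
  assert (Hst : t <= s) by (unfold s, t; apply pow_incr; lra).
  assert (Ht : 0 <= t) by (unfold t; nra).
  assert (E : Cmod (radial_cube z - radial_cube w) ^ 2 = t ^ 2 * Cmod (z - w) ^ 2
     + 2 * t * (s - t) * (s - Re (w * Cconj z)%C) + (s - t) ^ 2 * s).
  { unfold radial_cube. fold s t. rewrite !Cmod2_alt.
    replace (Re (w * Cconj z)%C) with (Re z * Re w + Im z * Im w)
      by (destruct z, w; simpl; ring).
    replace s with (Re z ^ 2 + Im z ^ 2) by (unfold s; now rewrite Cmod2_alt).
    clearbody t. destruct z as [z1 z2], w as [w1 w2]. simpl. ring. }
  rewrite E.
  assert (Hre : Re (w * Cconj z)%C <= s).
  { pose proof (Rle_abs (Re (w * Cconj z)%C)). pose proof (re_le_Cmod (w * Cconj z)) as Hr.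
    rewrite Cmod_mult, Cmod_conj in Hr. unfold s. nra. }
  assert (0 <= 2 * t * (s - t) * (s - Re (w * Cconj z)%C))
    by (repeat apply Rmult_le_pos; lra).
  assert (0 <= (s - t) ^ 2 * s) by (apply Rmult_le_pos; [apply pow2_ge_0|lra]).
  lra.
Qed.

(** Write the terms as [phi z * radial_cube z] with [phi z = f z / z - c].  The product
    rule needs [|phi|] and [|w|^3 |phi z - phi w|]; by [radial_cube_expansion] the
    latter is controlled by [|w|] times the difference of the radial cubes.  The
    constant is [K r / (1 - r) + K r / (1 - r)^2]. *)
Lemma higher_order_part_lipschitz (f : C -> C) (c : C) (M r : R) :
  hol2 (disk 1) f -> f 0 = 0 -> cderiv f 0 c -> 1 <= Cmod c ->
  (forall z, disk 1 z -> Cmod (f z) <= M) ->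
  0 <= r < 1 -> forall z w, Cmod z <= r -> Cmod w <= r ->
  Cmod (RtoC (Cmod z ^ 2) * (f z - c * z) - RtoC (Cmod w ^ 2) * (f w - c * w))%C * (1 - r) ^ 2
  <= (M - 1 / M) * (2 * r - r ^ 2) * Cmod (radial_cube z - radial_cube w).
Proof.
  intros Hf H0 Hc Hc1 HM Hr.
  destruct (bounded_function_estimates f c M Hf H0 Hc Hc1 HM) as [HM1 [E1 E2]].
  set (K := M - 1 / M) in *.
  assert (HK : 0 <= K) by now apply minus_inv_ge_0.
  enough (Hwlog : forall z w, Cmod w <= Cmod z -> Cmod z <= r ->
    Cmod (RtoC (Cmod z ^ 2) * (f z - c * z) - RtoC (Cmod w ^ 2) * (f w - c * w))%C * (1 - r) ^ 2
    <= K * (2 * r - r ^ 2) * Cmod (radial_cube z - radial_cube w)).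
  { intros z w Hz Hw. destruct (Rle_lt_dec (Cmod w) (Cmod z)).
    - now apply Hwlog.
    - rewrite Cmod_minus_sym, (Cmod_minus_sym (radial_cube z)). apply Hwlog; lra. }
  intros z w Hwz Hz.
  assert (Hform : forall y : C, y <> 0 -> (RtoC (Cmod y ^ 2) * (f y - c * y))%C
       = ((f y / y - c) * radial_cube y)%C).
  { intros y Hy. unfold radial_cube. field. auto. }
  assert (Hcube : forall y, Cmod (radial_cube y) = Cmod y ^ 2 * Cmod y).
  { intro y. unfold radial_cube. rewrite Cmod_mult, Cmod_R, Rabs_pos_eq by apply pow2_ge_0.
    reflexivity. }
  destruct (classic (z = 0)) as [->|Hz0].
  { rewrite Cmod_0 in Hwz. assert (w = 0) as ->
      by (apply Cmod_eq_0; pose proof (Cmod_ge_0 w); lra).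
    rewrite !Cmod_self_minus. lra. }
  assert (Hzp : punctured 0 z) by (repeat split; auto; lra).
  specialize (E1 z Hzp). rewrite (Hform z Hz0).
  pose proof (Cmod_ge_0 z).
  set (phi := (f z / z - c)%C) in *.
  assert (Hphi : Cmod phi * (1 - r) <= K * r).
  { apply Rle_trans with (Cmod phi * (1 - Cmod z)).
    - apply Rmult_le_compat_l; [apply Cmod_ge_0|lra].
    - eapply Rle_trans; [exact E1|]. apply Rmult_le_compat_l; lra. }
  assert (Hphi2 : Cmod phi * (1 - r) ^ 2 <= K * r * (1 - r)).
  { simpl. rewrite Rmult_1_r, <- Rmult_assoc. apply Rmult_le_compat_r; lra. }
  pose proof (Cmod_ge_0 (radial_cube z - radial_cube w)) as HD.
  destruct (classic (w = 0)) as [->|Hw0].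
  - replace (RtoC (Cmod 0 ^ 2)) with (RtoC 0) by (rewrite Cmod_0; f_equal; ring).
    replace (phi * radial_cube z - 0 * (f 0 - c * 0))%C with (phi * radial_cube z)%C by ring.
    assert (Hc00 : radial_cube 0 = 0) by (unfold radial_cube; ring). rewrite Hc00 in *.
    replace (radial_cube z - 0)%C with (radial_cube z) in * by ring.
    rewrite Cmod_mult.
    apply Rle_trans with (K * r * (1 - r) * Cmod (radial_cube z)).
    + apply (Rmult_le_compat_r (Cmod (radial_cube z))) in Hphi2; auto. lra.
    + apply Rmult_le_compat_r; auto. assert (0 <= K * r) by (apply Rmult_le_pos; lra). nra.
  - assert (Hwp : punctured 0 w) by (repeat split; auto; lra).
    rewrite (Hform w Hw0).
    specialize (E2 z w r (proj2 Hr) Hzp Hwp Hz ltac:(lra)).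
    pose proof (radial_cube_expansion z w Hwz) as Hexp.
    replace (phi * radial_cube z - (f w / w - c) * radial_cube w)%C
      with (phi * (radial_cube z - radial_cube w) + radial_cube w * (f z / z - f w / w))%C
      by (unfold phi; ring).
    apply Rle_trans with ((Cmod phi * Cmod (radial_cube z - radial_cube w)
        + Cmod (radial_cube w) * Cmod (f z / z - f w / w)) * (1 - r) ^ 2).
    { apply Rmult_le_compat_r; [apply pow2_ge_0|].
      rewrite <- !Cmod_mult. apply Cmod_triangle. }
    rewrite Hcube. pose proof (Cmod_ge_0 w).
    set (D := Cmod (radial_cube z - radial_cube w)) in *.
    set (X := Cmod (f z / z - f w / w)) in *.
    assert (F1 : Cmod phi * D * (1 - r) ^ 2 <= K * r * (1 - r) * D).
    { apply (Rmult_le_compat_r D) in Hphi2; auto. lra. }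
    assert (F2 : Cmod w ^ 2 * Cmod w * X * (1 - r) ^ 2 <= K * r * D).
    { apply Rle_trans with (Cmod w ^ 2 * Cmod w * (K * Cmod (z - w))).
      - rewrite Rmult_assoc. apply Rmult_le_compat_l; auto.
        apply Rmult_le_pos; [apply pow2_ge_0|auto].
      - replace (Cmod w ^ 2 * Cmod w * (K * Cmod (z - w)))
          with (K * Cmod w * (Cmod w ^ 2 * Cmod (z - w))) by ring.
        apply Rmult_le_compat; auto.
        + now apply Rmult_le_pos.
        + apply Rmult_le_pos; [apply pow2_ge_0|apply Cmod_ge_0].
        + apply Rmult_le_compat_l; lra. }
    nra.
Qed.

(** * Regularity of the analytic components of a harmonic function *)

Lemma cderiv_of_little_o (f : C -> C) (z l : C) :
  (forall eps, 0 < eps -> exists d, 0 < d /\ forall y, Cmod (y - z) < d ->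
     Cmod (f y - f z - l * (y - z))%C <= eps * Cmod (y - z)) ->
  cderiv f z l.
Proof.
  intro H.
  exists (fun y => if excluded_middle_informative (y = z) then l
                   else ((f y - f z) / (y - z))%C), 1.
  split; [lra|]. split; [|split].
  - intros eps He. destruct (H (eps / 2) ltac:(lra)) as [d [Hd Hd']].
    exists d. split; auto. intros y Hy.
    destruct (excluded_middle_informative (z = z)) as [_|n]; [|now elim n].
    destruct (excluded_middle_informative (y = z)) as [->|Hne].
    + now rewrite Cmod_self_minus.
    + assert (Hyz : (y - z <> 0)%C) by (intro E; apply Hne; now apply Csub_eq).
      pose proof (proj1 (Cmod_gt_0 _) Hyz).
      replace ((f y - f z) / (y - z) - l)%C with ((f y - f z - l * (y - z)) / (y - z))%C
        by (field; auto).
      rewrite Cmod_div by auto. apply Rlt_div_l; auto. specialize (Hd' y Hy). nra.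
  - destruct (excluded_middle_informative (z = z)) as [_|n]; [auto|now elim n].
  - intros y _. destruct (excluded_middle_informative (y = z)) as [->|Hne]; [ring|].
    assert (Hyz : (y - z <> 0)%C) by (intro E; apply Hne; now apply Csub_eq).
    field. auto.
Qed.

Lemma cderiv_of_ex_derive (f : C -> C) (z : C) :
  @ex_derive C_AbsRing C_NormedModule f z -> exists l, cderiv f z l.
Proof.
  intros [l [_ Hl]]. exists l. apply cderiv_of_little_o. intros eps He.
  destruct (Hl z (fun P HP => HP) (mkposreal eps He)) as [d Hd].
  exists d. split; [apply cond_pos|]. intros y Hy.
  specialize (Hd y Hy).
  change (Cmod ((f y + - f z) + - ((y + - z) * l))%C <= eps * Cmod (y - z)) in Hd.
  replace (f y - f z - l * (y - z))%C with ((f y + - f z) + - ((y + - z) * l))%C by ring.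
  exact Hd.
Qed.

Lemma cderiv_cauchy_riemann (P Q : R -> R -> R) (x y a b : R) :
  differentiable_pt_lim P x y a (- b) -> differentiable_pt_lim Q x y b a ->
  cderiv (fun z : C => (P (fst z) (snd z), Q (fst z) (snd z))) (x, y) (a, b).
Proof.
  intros HP HQ. apply cderiv_of_little_o. intros eps He.
  destruct (HP (mkposreal (eps / 2) ltac:(lra))) as [d1 H1].
  destruct (HQ (mkposreal (eps / 2) ltac:(lra))) as [d2 H2].
  exists (Rmin d1 d2). split; [apply Rmin_pos; apply cond_pos|].
  intros [u v] Huv. pose proof (Rmin_l d1 d2). pose proof (Rmin_r d1 d2).
  pose proof (Rmax_Cmod ((u, v) - (x, y))%C) as Hmx. simpl in Hmx.
  pose proof (Rmax_l (Rabs (u + - x)) (Rabs (v + - y))).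
  pose proof (Rmax_r (Rabs (u + - x)) (Rabs (v + - y))).
  specialize (H1 u v). specialize (H2 u v). unfold Rminus in H1, H2.
  specialize (H1 ltac:(lra) ltac:(lra)). specialize (H2 ltac:(lra) ltac:(lra)).
  simpl pos in H1, H2.
  set (e1 := P u v + - P x y + - (a * (u + - x) + - b * (v + - y))) in *.
  set (e2 := Q u v + - Q x y + - (b * (u + - x) + a * (v + - y))) in *.
  simpl fst. simpl snd.
  replace ((P u v, Q u v) - (P x y, Q x y) - (a, b) * ((u, v) - (x, y)))%C
    with (RtoC e1 + Ci * RtoC e2)%C
    by (unfold e1, e2; apply injective_projections; simpl; ring).
  eapply Rle_trans; [apply Cmod_triangle|]. rewrite Cmod_mult, Cmod_Ci, !Cmod_R.
  apply (Rmult_le_compat_l (eps / 2)) in Hmx; [|lra]. lra.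
Qed.

Lemma differentiable_pt_lim_linear (f g : R -> R -> R) (x y a b c d k m : R) :
  differentiable_pt_lim f x y a b -> differentiable_pt_lim g x y c d ->
  differentiable_pt_lim (fun u v => k * f u v + m * g u v) x y
    (k * a + m * c) (k * b + m * d).
Proof.
  intros Hf Hg eps.
  pose proof (Rabs_pos k). pose proof (Rabs_pos m). pose proof (cond_pos eps).
  assert (He : 0 < eps / (Rabs k + Rabs m + 1)) by (apply Rdiv_lt_0_compat; lra).
  generalize (locally_2d_and _ _ _ _ (Hf (mkposreal _ He)) (Hg (mkposreal _ He))).
  apply locally_2d_impl. apply locally_2d_forall. intros u v [HX HY].
  simpl pos in *. set (e := eps / (Rabs k + Rabs m + 1)) in *.
  set (r := Rmax (Rabs (u - x)) (Rabs (v - y))) in *.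
  assert (Hr : 0 <= r) by (unfold r; eapply Rle_trans; [apply Rabs_pos|apply Rmax_l]).
  set (X := f u v - f x y - (a * (u - x) + b * (v - y))) in *.
  set (Y := g u v - g x y - (c * (u - x) + d * (v - y))) in *.
  replace (k * f u v + m * g u v - (k * f x y + m * g x y)
     - ((k * a + m * c) * (u - x) + (k * b + m * d) * (v - y))) with (k * X + m * Y)
    by (unfold X, Y; ring).
  eapply Rle_trans; [apply Rabs_triang|]. rewrite !Rabs_mult.
  assert (Rabs k * Rabs X <= Rabs k * (e * r)) by (apply Rmult_le_compat_l; auto).
  assert (Rabs m * Rabs Y <= Rabs m * (e * r)) by (apply Rmult_le_compat_l; auto).
  assert (Ee : e * (Rabs k + Rabs m + 1) = eps) by (unfold e; field; lra).
  assert (0 <= e * r) by (apply Rmult_le_pos; lra).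
  rewrite <- Ee. lra.
Qed.

Definition Dx (u : R -> R -> R) (x y : R) : R := Derive (fun t => u t y) x.
Definition Dy (u : R -> R -> R) (x y : R) : R := Derive (fun t => u x t) y.

Lemma disk_locally_2d (x y : R) : disk 1 (x, y) -> locally_2d (fun u v => disk 1 (u, v)) x y.
Proof.
  unfold disk. intro H. exists (mkposreal ((1 - Cmod (x, y)) / 2) ltac:(lra)).
  simpl. intros u v Hu Hv.
  pose proof (Cmod_sub_le (u, v) (x, y)).
  assert (Cmod ((u, v) - (x, y)) < 2 * ((1 - Cmod (x, y)) / 2))
    by (apply Cmod_lt_of_coordinates; assumption).
  lra.
Qed.

Lemma differentiable_of_C1 (u : R -> R -> R) :
  (forall x y, disk 1 (x, y) -> ex_diff_n u 1 x y) ->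
  forall x y, disk 1 (x, y) -> differentiable_pt_lim u x y (Dx u x y) (Dy u x y).
Proof.
  intros Hu x y Hxy. apply filterdiff_differentiable_pt_lim.
  apply (is_derive_filterdiff u x y (Dx u) (Dy u x y)).
  - destruct (disk_locally_2d x y Hxy) as [d Hd]. exists d. intros [a b] [Ha Hb].
    simpl in *. destruct (Hu a b (Hd a b Ha Hb)) as [_ [H _]].
    now apply Derive_correct.
  - destruct (Hu x y Hxy) as [_ [_ [H _]]]. now apply Derive_correct.
  - apply (continuity_2d_pt_filterlim (Dx u)). destruct (Hu x y Hxy) as [_ [_ [_ [H _]]]].
    apply H.
Qed.

(** Equality of mixed derivatives and Laplace's equation leave two independent second
    derivatives. *)
Lemma harmonic_partials (u : R -> R -> R) :
  real_harmonic_on (disk 1) u -> forall x y, disk 1 (x, y) ->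
  differentiable_pt_lim (Dx u) x y (Dx (Dx u) x y) (Dx (Dy u) x y) /\
  differentiable_pt_lim (Dy u) x y (Dx (Dy u) x y) (- Dx (Dx u) x y).
Proof.
  intros Hu x y Hxy.
  assert (Hx : forall a b, disk 1 (a, b) -> ex_diff_n (Dx u) 1 a b)
    by (intros a b Hab; apply (Hu a b Hab)).
  assert (Hy : forall a b, disk 1 (a, b) -> ex_diff_n (Dy u) 1 a b)
    by (intros a b Hab; apply (Hu a b Hab)).
  assert (Hlap : Dy (Dy u) x y = - Dx (Dx u) x y).
  { destruct (Hu x y Hxy) as [_ H].
    change (Dx (Dx u) x y + Dy (Dy u) x y = 0) in H. lra. }
  assert (HS : Dx (Dy u) x y = Dy (Dx u) x y).
  { apply Schwarz.
    - generalize (disk_locally_2d x y Hxy). apply locally_2d_impl.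
      apply locally_2d_forall. intros a b Hab.
      destruct (Hu a b Hab) as [[_ [H1 [H2 _]]] _].
      destruct (Hx a b Hab) as [_ [_ [H3 _]]]. destruct (Hy a b Hab) as [_ [H4 _]].
      repeat split; assumption.
    - destruct (Hy x y Hxy) as [_ [_ [_ [H _]]]]. apply H.
    - destruct (Hx x y Hxy) as [_ [_ [_ [_ H]]]]. apply H. }
  split.
  - rewrite HS. now apply differentiable_of_C1.
  - rewrite <- Hlap. now apply differentiable_of_C1.
Qed.

(** For [s = 1] and [s = -1] the prescribed derivative is that of [g1] and of [g2] in
    [u + i v = g1 + conj g2].  It is of class C^1 and satisfies the Cauchy-Riemann
    equations, so it is complex differentiable in turn. *)
Lemma harmonic_derivative_holomorphic (u v : R -> R -> R) (s : R) (f : C -> C) :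
  real_harmonic_on (disk 1) u -> real_harmonic_on (disk 1) v ->
  (forall x y, disk 1 (x, y) -> cderiv f (x, y)
     (/ 2 * Dx u x y + s / 2 * Dy v x y, s / 2 * Dx v x y + - / 2 * Dy u x y)) ->
  hol2 (disk 1) f.
Proof.
  intros Hu Hv Hf.
  exists (fun z : C => (/ 2 * Dx u (fst z) (snd z) + s / 2 * Dy v (fst z) (snd z),
     s / 2 * Dx v (fst z) (snd z) + - / 2 * Dy u (fst z) (snd z))).
  intros [x y] Hxy. split; [now apply Hf|].
  destruct (harmonic_partials u Hu x y Hxy) as [U1 U2].
  destruct (harmonic_partials v Hv x y Hxy) as [V1 V2].
  exists (/ 2 * Dx (Dx u) x y + s / 2 * Dx (Dy v) x y,
          s / 2 * Dx (Dx v) x y + - / 2 * Dx (Dy u) x y).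
  apply (cderiv_cauchy_riemann
    (fun a b => / 2 * Dx u a b + s / 2 * Dy v a b)
    (fun a b => s / 2 * Dx v a b + - / 2 * Dy u a b)).
  - replace (- (s / 2 * Dx (Dx v) x y + - / 2 * Dx (Dy u) x y))
      with (/ 2 * Dx (Dy u) x y + s / 2 * (- Dx (Dx v) x y)) by ring.
    now apply differentiable_pt_lim_linear.
  - replace (/ 2 * Dx (Dx u) x y + s / 2 * Dx (Dy v) x y)
      with (s / 2 * Dx (Dy v) x y + - / 2 * (- Dx (Dx u) x y)) by ring.
    now apply differentiable_pt_lim_linear.
Qed.

Lemma partials_of_decomposition (g g1 g2 : C -> C) (x y : R) (k l : C) :
  (forall z, disk 1 z -> g z = (g1 z + Cconj (g2 z))%C) ->
  disk 1 (x, y) -> cderiv g1 (x, y) k -> cderiv g2 (x, y) l ->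
  Dx (fun a b => Re (g (a, b))) x y = Re k + Re l /\
  Dy (fun a b => Re (g (a, b))) x y = - Im k - Im l /\
  Dx (fun a b => Im (g (a, b))) x y = Im k - Im l /\
  Dy (fun a b => Im (g (a, b))) x y = Re k - Re l.
Proof.
  intros Hg Hxy Hk Hl.
  destruct (disk_locally_2d x y Hxy) as [d Hd].
  assert (Hx : forall t : R, (x, t) = ((x, 0) + t * Ci)%C)
    by (intro t; apply injective_projections; simpl; ring).
  assert (Hy : forall t : R, (t, y) = ((0, y) + t * 1)%C)
    by (intro t; apply injective_projections; simpl; ring).
  rewrite (Hy x) in Hk, Hl.
  destruct (cderiv_along _ _ _ _ _ Hk) as [K1 K2].
  destruct (cderiv_along _ _ _ _ _ Hl) as [L1 L2].
  rewrite <- (Hy x), (Hx y) in Hk, Hl.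
  destruct (cderiv_along _ _ _ _ _ Hk) as [K3 K4].
  destruct (cderiv_along _ _ _ _ _ Hl) as [L3 L4].
  assert (Hd0 : forall r : R, Rabs (r - r) < d)
    by (intro r; rewrite Rminus_diag, Rabs_R0; apply cond_pos).
  unfold Dx, Dy. repeat split; apply is_derive_unique.
  - apply is_derive_ext_loc
      with (fun t : R => Re (g1 ((0, y) + t * 1)%C) + Re (g2 ((0, y) + t * 1)%C)).
    + exists d. intros t Ht. rewrite Hg by (apply Hd; auto).
      rewrite re_plus, re_conj, <- Hy. reflexivity.
    + replace (Re k + Re l) with (Re (k * 1)%C + Re (l * 1)%C)
        by (rewrite !re_mult; simpl; ring).
      apply (is_derive_plus (K := R_AbsRing) (V := R_NormedModule)); assumption.
  - apply is_derive_ext_loc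
      with (fun t : R => Re (g1 ((x, 0) + t * Ci)%C) + Re (g2 ((x, 0) + t * Ci)%C)).
    + exists d. intros t Ht. rewrite Hg by (apply Hd; auto).
      rewrite re_plus, re_conj, <- Hx. reflexivity.
    + replace (- Im k - Im l) with (Re (k * Ci)%C + Re (l * Ci)%C)
        by (rewrite !re_mult_Ci; ring).
      apply (is_derive_plus (K := R_AbsRing) (V := R_NormedModule)); assumption.
  - apply is_derive_ext_loc
      with (fun t : R => Im (g1 ((0, y) + t * 1)%C) - Im (g2 ((0, y) + t * 1)%C)).
    + exists d. intros t Ht. rewrite Hg by (apply Hd; auto).
      rewrite im_plus, im_conj, <- Hy. reflexivity.
    + replace (Im k - Im l) with (Im (k * 1)%C - Im (l * 1)%C)
        by (rewrite !im_mult; simpl; ring).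
      apply (is_derive_minus (K := R_AbsRing) (V := R_NormedModule)); assumption.
  - apply is_derive_ext_loc
      with (fun t : R => Im (g1 ((x, 0) + t * Ci)%C) - Im (g2 ((x, 0) + t * Ci)%C)).
    + exists d. intros t Ht. rewrite Hg by (apply Hd; auto).
      rewrite im_plus, im_conj, <- Hx. reflexivity.
    + replace (Re k - Re l) with (Im (k * Ci)%C - Im (l * Ci)%C)
        by (rewrite !im_mult; simpl; ring).
      apply (is_derive_minus (K := R_AbsRing) (V := R_NormedModule)); assumption.
Qed.

Lemma components_hol2 (g g1 g2 : C -> C) :
  harmonic_on (disk 1) g -> analytic_on (disk 1) g1 -> analytic_on (disk 1) g2 ->
  (forall z, disk 1 z -> g z = (g1 z + Cconj (g2 z))%C) ->
  hol2 (disk 1) g1 /\ hol2 (disk 1) g2.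
Proof.
  intros [Hu Hv] H1 H2 Hg. split.
  - apply (harmonic_derivative_holomorphic _ _ 1 _ Hu Hv). intros x y Hxy.
    destruct (cderiv_of_ex_derive _ _ (H1 _ Hxy)) as [k Hk].
    destruct (cderiv_of_ex_derive _ _ (H2 _ Hxy)) as [l Hl].
    destruct (partials_of_decomposition g g1 g2 x y k l Hg Hxy Hk Hl) as [-> [-> [-> ->]]].
    match goal with |- cderiv _ _ ?p => replace p with k; [assumption|] end.
    apply injective_projections; simpl; unfold Re, Im; field.
  - apply (harmonic_derivative_holomorphic _ _ (- 1) _ Hu Hv). intros x y Hxy.
    destruct (cderiv_of_ex_derive _ _ (H1 _ Hxy)) as [k Hk].
    destruct (cderiv_of_ex_derive _ _ (H2 _ Hxy)) as [l Hl].
    destruct (partials_of_decomposition g g1 g2 x y k l Hg Hxy Hk Hl) as [-> [-> [-> ->]]].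
    match goal with |- cderiv _ _ ?p => replace p with l; [assumption|] end.
    apply injective_projections; simpl; unfold Re, Im; field.
Qed.

Lemma lambda_at_0 (g g1 g2 : C -> C) (a b : C) :
  (forall z, disk 1 z -> g z = (g1 z + Cconj (g2 z))%C) ->
  cderiv g1 0 a -> cderiv g2 0 b -> lambda g 0 = Rabs (Cmod a - Cmod b).
Proof.
  intros Hg Ha Hb.
  assert (H0 : disk 1 (0, 0)) by (unfold disk; fold (RtoC 0); rewrite Cmod_0; lra).
  destruct (partials_of_decomposition g g1 g2 0 0 a b Hg H0 Ha Hb) as [E1 [E2 [E3 E4]]].
  unfold Dx, Dy in *. unfold lambda, d_z, d_zbar, d_x, d_y. simpl Re. simpl Im.
  rewrite E1, E2, E3, E4.
  f_equal. f_equal.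
  - f_equal. apply injective_projections; simpl; unfold Re, Im; field.
  - rewrite <- (Cmod_conj b). f_equal. f_equal.
    apply injective_projections; simpl; unfold Re, Im; field.
Qed.

(** * Injectivity and covering *)

(** A point where [|T z - z|] is minimal is fixed, since [T] decreases this quantity. *)
Lemma ball_fixed_point (T : C -> C) (rho q : R) :
  0 <= rho -> q < 1 ->
  (forall z, Cmod z <= rho -> Cmod (T z) <= rho) ->
  (forall z w, Cmod z <= rho -> Cmod w <= rho -> Cmod (T z - T w) <= q * Cmod (z - w)) ->
  exists z, Cmod z <= rho /\ T z = z.
Proof.
  intros Hrho Hq Hin Hlip.
  destruct (disc_max rho (fun z => - Cmod (T z - z)) Hrho) as [z [Hz Hmax]].
  - intros z Hz eps He. exists (eps / 2). split; [lra|]. intros y Hy Hyz.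
    specialize (Hlip z y Hz Hy). rewrite (Cmod_minus_sym z y) in Hlip.
    assert (q * Cmod (y - z) <= Cmod (y - z)) by (pose proof (Cmod_ge_0 (y - z)); nra).
    pose proof (Cmod_triangle (T z - T y) (T y - z)) as H1.
    replace (T z - T y + (T y - z))%C with (T z - z)%C in H1 by ring.
    pose proof (Cmod_triangle (T y - y) (y - z)) as H2.
    replace (T y - y + (y - z))%C with (T y - z)%C in H2 by ring. lra.
  - exists z. split; auto. apply Csub_eq, Cmod_eq_0.
    specialize (Hmax (T z) (Hin z Hz)). simpl in Hmax.
    specialize (Hlip (T z) z (Hin z Hz) Hz).
    pose proof (Cmod_ge_0 (T z - z)). nra.
Qed.

Lemma higher_order_part_bound (f : C -> C) (c : C) (M : R) :
  hol2 (disk 1) f -> f 0 = 0 -> cderiv f 0 c -> 1 <= Cmod c ->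
  (forall z, disk 1 z -> Cmod (f z) <= M) ->
  forall z, disk 1 z ->
  Cmod (RtoC (Cmod z ^ 2) * (f z - c * z))%C * (1 - Cmod z) <= (M - 1 / M) * Cmod z ^ 4.
Proof.
  intros Hf H0 Hc Hc1 HM z Hz.
  destruct (bounded_function_estimates f c M Hf H0 Hc Hc1 HM) as [HM1 [E1 _]].
  destruct (classic (z = 0)) as [->|Hz0].
  { rewrite Cmod_0, H0. replace (RtoC (0 ^ 2) * (0 - c * 0))%C with (RtoC 0) by ring.
    rewrite Cmod_0. lra. }
  specialize (E1 z ltac:(repeat split; auto)).
  replace (RtoC (Cmod z ^ 2) * (f z - c * z))%C
    with (RtoC (Cmod z ^ 2) * z * (f z / z - c))%C by (field; auto).
  rewrite !Cmod_mult, Cmod_R, Rabs_pos_eq by apply pow2_ge_0.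
  pose proof (Cmod_ge_0 z).
  replace ((M - 1 / M) * Cmod z ^ 4)
    with (Cmod z ^ 2 * Cmod z * ((M - 1 / M) * Cmod z)) by ring.
  rewrite Rmult_assoc. apply Rmult_le_compat_l; auto.
  apply Rmult_le_pos; [apply pow2_ge_0|auto].
Qed.

Definition real_linear (a b zeta : C) : C := (a * zeta + Cconj (b * zeta))%C.

Lemma real_linear_minus (a b z w : C) :
  real_linear a b (z - w) = (real_linear a b z - real_linear a b w)%C.
Proof. unfold real_linear. rewrite !Cmult_conj, Cminus_conj. ring. Qed.

Lemma real_linear_ge (a b z : C) : Rabs (Cmod a - Cmod b) * Cmod z <= Cmod (real_linear a b z).
Proof.
  unfold real_linear. rewrite <- (Rabs_pos_eq (Cmod z)), <- Rabs_mult by apply Cmod_ge_0.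
  pose proof (Cmod_sub_le (a * z) (- Cconj (b * z))) as H1.
  pose proof (Cmod_sub_le (Cconj (b * z)) (- (a * z))) as H2.
  replace (a * z - - Cconj (b * z))%C with (a * z + Cconj (b * z))%C in H1 by ring.
  replace (Cconj (b * z) - - (a * z))%C with (a * z + Cconj (b * z))%C in H2 by ring.
  rewrite Cmod_opp, Cmod_conj, !Cmod_mult in H1.
  rewrite Cmod_opp, Cmod_conj, !Cmod_mult in H2.
  apply Rabs_le. lra.
Qed.

Definition real_linear_inv (a b w : C) : C :=
  ((Cconj a * w - Cconj b * Cconj w) / RtoC (Cmod a ^ 2 - Cmod b ^ 2))%C.

Lemma real_linear_inv_r (a b w : C) :
  Cmod a <> Cmod b -> real_linear a b (real_linear_inv a b w) = w.
Proof.
  intro Hab.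
  assert (HD : RtoC (Cmod a ^ 2 - Cmod b ^ 2) <> 0).
  { intro E. apply RtoC_inj in E. pose proof (Cmod_ge_0 a). pose proof (Cmod_ge_0 b).
    apply Hab. nra. }
  unfold real_linear, real_linear_inv. rewrite Cmult_conj, Cdiv_conj by auto.
  rewrite Cminus_conj, !Cmult_conj, !Cconj_conj.
  replace (Cconj (RtoC (Cmod a ^ 2 - Cmod b ^ 2))) with (RtoC (Cmod a ^ 2 - Cmod b ^ 2))
    by (apply injective_projections; simpl; ring).
  rewrite RtoC_minus, !Cmod2_conj in *. field. exact HD.
Qed.

(** [a] and [b] are the derivatives of [g1] and [g2] at 0.  The remainder [S] is estimated
    as the sum of the moduli of its two analytic parts, hence as a single
    [f = g1 + u g2] with [u] chosen for the points at hand. *)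
Lemma admissible_decomposition (M : R) (g : C -> C) : admissible M g ->
  1 <= M /\ exists a b, Rabs (Cmod a - Cmod b) = 1 /\
  let S := fun z => (F g z - real_linear a b (radial_cube z))%C in
  (forall z w r, 0 <= r < 1 -> Cmod z <= r -> Cmod w <= r ->
     Cmod (S z - S w) * (1 - r) ^ 2
     <= (M - 1 / M) * (2 * r - r ^ 2) * Cmod (radial_cube z - radial_cube w)) /\
  (forall z, disk 1 z -> Cmod (S z) * (1 - Cmod z) <= (M - 1 / M) * Cmod z ^ 4).
Proof.
  intros [Hharm [g1 [g2 [H1 [H2 [Hg [H20 [Hg0 [Hlam Hbound]]]]]]]]].
  destruct (components_hol2 g g1 g2 Hharm H1 H2 Hg) as [Hh1 Hh2].
  assert (HD0 : disk 1 0) by (unfold disk; rewrite Cmod_0; lra).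
  destruct (cderiv_of_ex_derive _ _ (H1 0 HD0)) as [a Ha].
  destruct (cderiv_of_ex_derive _ _ (H2 0 HD0)) as [b Hb].
  assert (H10 : g1 0 = 0).
  { specialize (Hg 0 HD0). rewrite Hg0, H20 in Hg.
    replace (g1 0) with (g1 0 + Cconj 0)%C; [now rewrite <- Hg|].
    apply injective_projections; simpl; ring. }
  rewrite (lambda_at_0 g g1 g2 a b Hg Ha Hb) in Hlam.
  (* For |u| = 1, |g1 + u g2| <= |g1| + |g2| <= M and
     |a + u b| >= ||a| - |b|| = 1, so the estimates for bounded functions apply. *)
  assert (Hu : forall u, Cmod u = 1 ->
    hol2 (disk 1) (fun z => g1 z + u * g2 z)%C /\ (g1 0 + u * g2 0)%C = 0 /\
    cderiv (fun z => g1 z + u * g2 z)%C 0 (a + u * b) /\ 1 <= Cmod (a + u * b)%C /\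
    (forall z, disk 1 z -> Cmod (g1 z + u * g2 z)%C <= M)).
  { intros u Hu. repeat split.
    - apply hol2_plus; auto. apply hol2_mult; auto using hol2_const.
    - rewrite H10, H20. ring.
    - apply cderiv_plus; auto.
      replace (u * b)%C with (0 * g2 0 + u * b)%C by ring.
      apply (cderiv_mult (fun _ => u)); auto using cderiv_const.
    - pose proof (Cmod_sub_le a (- (u * b))) as E1.
      pose proof (Cmod_sub_le (u * b) (- a)) as E2.
      replace (a - - (u * b))%C with (a + u * b)%C in E1 by ring.
      replace (u * b - - a)%C with (a + u * b)%C in E2 by ring.
      rewrite Cmod_opp, Cmod_mult, Hu in E1. rewrite Cmod_opp, Cmod_mult, Hu in E2.
      revert Hlam. unfold Rabs. destruct (Rcase_abs (Cmod a - Cmod b)); lra.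
    - intros z Hz. eapply Rle_trans; [apply Cmod_triangle|].
      rewrite Cmod_mult, Hu, Rmult_1_l. auto. }
  split.
  { destruct (Hu 1 Cmod_1) as [U1 [U2 [U3 [U4 U5]]]].
    exact (proj1 (bounded_function_estimates _ _ M U1 U2 U3 U4 U5)). }
  exists a, b. split; [lra|].
  set (k1 := fun z => (RtoC (Cmod z ^ 2) * (g1 z - a * z))%C).
  set (k2 := fun z => (RtoC (Cmod z ^ 2) * (g2 z - b * z))%C).
  assert (Hconj : forall t : R, Cconj t = t)
    by (intro t; apply injective_projections; simpl; ring).
  assert (HS : forall z, disk 1 z ->
     (F g z - real_linear a b (radial_cube z))%C = (k1 z + Cconj (k2 z))%C).
  { intros z Hz. unfold F, real_linear, radial_cube, k1, k2.
    rewrite (Hg z Hz), !Cmult_conj, Cminus_conj, !Cmult_conj, !Hconj. ring. }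
  split.
  - intros z w r Hr Hz Hw.
    rewrite !HS by (unfold disk; lra).
    replace (k1 z + Cconj (k2 z) - (k1 w + Cconj (k2 w)))%C
      with ((k1 z - k1 w) + Cconj (k2 z - k2 w))%C by (rewrite Cminus_conj; ring).
    destruct (aligned_sum (k1 z - k1 w) (k2 z - k2 w)) as [u [Hu1 Hal]].
    destruct (Hu u Hu1) as [U1 [U2 [U3 [U4 U5]]]].
    eapply Rle_trans;
      [|exact (higher_order_part_lipschitz _ _ M r U1 U2 U3 U4 U5 Hr z w Hz Hw)].
    apply Rmult_le_compat_r; [apply pow2_ge_0|].
    eapply Rle_trans; [apply Cmod_triangle|]. rewrite Cmod_conj, Hal.
    right. f_equal. unfold k1, k2. ring.
  - intros z Hz. rewrite HS by auto.
    destruct (aligned_sum (k1 z) (k2 z)) as [u [Hu1 Hal]].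
    destruct (Hu u Hu1) as [U1 [U2 [U3 [U4 U5]]]].
    eapply Rle_trans; [|exact (higher_order_part_bound _ _ M U1 U2 U3 U4 U5 z Hz)].
    unfold disk in Hz.
    apply Rmult_le_compat_r; [lra|].
    eapply Rle_trans; [apply Cmod_triangle|]. rewrite Cmod_conj, Hal.
    right. f_equal. unfold k1, k2. ring.
Qed.

Lemma radial_cube_inj (z w : C) : radial_cube z = radial_cube w -> z = w.
Proof.
  enough (H : forall z w, Cmod w <= Cmod z -> radial_cube z = radial_cube w -> z = w).
  { intro E. destruct (Rle_lt_dec (Cmod w) (Cmod z)); [auto|symmetry; apply H; auto; lra]. }
  clear z w. intros z w Hwz E. pose proof (radial_cube_expansion z w Hwz) as H.
  rewrite E, Cmod_self_minus in H.
  destruct (classic (w = 0)) as [->|Hw].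
  - replace (radial_cube 0) with (RtoC 0) in E by (unfold radial_cube; ring).
    apply NNPP. intro Hz. revert E. unfold radial_cube. apply Cmult_neq_0; auto.
    intro E. apply RtoC_inj in E. apply Cmod_gt_0 in Hz. nra.
  - apply Cmod_gt_0 in Hw. apply Csub_eq, Cmod_eq_0. pose proof (Cmod_ge_0 (z - w)).
    assert (0 < Cmod w ^ 2) by (apply pow_lt; auto). nra.
Qed.

Lemma Cmod_radial_cube (z : C) : Cmod (radial_cube z) = Cmod z ^ 3.
Proof.
  unfold radial_cube. rewrite Cmod_mult, Cmod_R, Rabs_pos_eq by apply pow2_ge_0. ring.
Qed.

Definition radial_root (zeta : C) : C := (RtoC (Rpower (Cmod zeta) (- (2 / 3))) * zeta)%C.

Lemma radial_cube_root (zeta : C) : radial_cube (radial_root zeta) = zeta.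
Proof.
  destruct (classic (zeta = 0)) as [->|Hz].
  - unfold radial_cube, radial_root. ring.
  - apply Cmod_gt_0 in Hz. unfold radial_cube, radial_root.
    set (m := Cmod zeta) in *. set (k := Rpower m (- (2 / 3))).
    assert (Hk : 0 < k) by apply exp_pos.
    rewrite Cmod_mult, Cmod_R, Rabs_pos_eq by lra. fold m.
    replace (RtoC ((k * m) ^ 2) * (k * zeta))%C with (RtoC (k * k * k * (m * m)) * zeta)%C
      by (rewrite !RtoC_pow, !RtoC_mult; ring).
    assert (E : k * k * k * (m * m) = 1).
    { unfold k. rewrite <- !Rpower_plus.
      replace (- (2 / 3) + - (2 / 3) + - (2 / 3)) with (- (1 + 1)) by field.
      rewrite Rpower_Ropp, Rpower_plus, Rpower_1 by auto. field. lra. }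
    rewrite E. ring.
Qed.

Lemma radial_cube_radius_lt (z : C) (r : R) :
  0 <= r -> Cmod (radial_cube z) < r ^ 3 -> Cmod z < r.
Proof.
  intros Hr H. rewrite Cmod_radial_cube in H. apply Rnot_le_lt. intro Hle.
  assert (r ^ 3 <= Cmod z ^ 3) by (apply pow_incr; lra). lra.
Qed.

Lemma radial_cube_radius_le (z : C) (r : R) :
  0 <= r -> Cmod (radial_cube z) <= r ^ 3 -> Cmod z <= r.
Proof.
  intros Hr H. rewrite Cmod_radial_cube in H. apply Rnot_lt_le. intro Hlt.
  assert (r ^ 3 < Cmod z ^ 3); [|lra].
  pose proof (Cmod_ge_0 z). simpl. rewrite !Rmult_1_r.
  apply Rmult_le_0_lt_compat; auto; [nra|]. apply Rmult_le_0_lt_compat; auto.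
Qed.

(** In the variable [radial_cube z], [F g] is a real-linear map expanding distances
    plus a contraction. *)
Lemma F_injective (M r : R) (g : C -> C) (z w : C) : admissible M g ->
  0 <= r < 1 -> (M - 1 / M) * (2 * r - r ^ 2) < (1 - r) ^ 2 ->
  Cmod z <= r -> Cmod w <= r -> F g z = F g w -> z = w.
Proof.
  intros Hg Hr Hq Hz Hw HF.
  destruct (admissible_decomposition M g Hg) as [_ [a [b [Hab [HS _]]]]].
  specialize (HS z w r Hr Hz Hw). rewrite HF in HS.
  replace (F g w - real_linear a b (radial_cube z) - (F g w - real_linear a b (radial_cube w)))%C
    with (- real_linear a b (radial_cube z - radial_cube w))%C in HS
    by (rewrite real_linear_minus; ring).
  rewrite Cmod_opp in HS. pose proof (real_linear_ge a b (radial_cube z - radial_cube w)) as Hge.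
  rewrite Hab, Rmult_1_l in Hge.
  apply radial_cube_inj, Csub_eq, Cmod_eq_0.
  pose proof (Cmod_ge_0 (radial_cube z - radial_cube w)).
  assert (Cmod (radial_cube z - radial_cube w) * (1 - r) ^ 2
     <= Cmod (real_linear a b (radial_cube z - radial_cube w)) * (1 - r) ^ 2)
    by (apply Rmult_le_compat_r; [apply pow2_ge_0|auto]).
  nra.
Qed.

(** [F g z = w] is the fixed-point equation
    [zeta = L^-1 (w - S zeta)] in [zeta = radial_cube z]; the bound on [w] is what makes
    the right-hand side map the closed disk of radius [r^3] into the open one. *)
Lemma F_covers (M r : R) (g : C -> C) (w : C) : admissible M g ->
  0 <= r < 1 -> (M - 1 / M) * (2 * r - r ^ 2) < (1 - r) ^ 2 ->
  Cmod w < r ^ 3 - (M - 1 / M) * (r ^ 4 / (1 - r)) ->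
  exists z, Cmod z < r /\ F g z = w.
Proof.
  intros Hg Hr Hq Hw.
  destruct (admissible_decomposition M g Hg) as [HM [a [b [Hab [HS HSb]]]]].
  set (K := M - 1 / M) in *.
  assert (HK : 0 <= K) by now apply minus_inv_ge_0.
  set (S := fun z => (F g z - real_linear a b (radial_cube z))%C) in *.
  assert (Hne : Cmod a <> Cmod b).
  { intro E. rewrite E, Rminus_diag, Rabs_R0 in Hab. lra. }
  assert (Hle : forall v, Cmod (real_linear_inv a b v) <= Cmod v).
  { intro v. pose proof (real_linear_ge a b (real_linear_inv a b v)) as H.
    rewrite Hab, Rmult_1_l, real_linear_inv_r in H; auto. }
  assert (Hr2 : 0 < (1 - r) ^ 2) by (apply pow_lt; lra).
  set (T := fun zeta => real_linear_inv a b (w - S (radial_root zeta))%C).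
  assert (Huc : forall zeta, Cmod zeta <= r ^ 3 -> Cmod (radial_root zeta) <= r).
  { intros zeta Hz. apply radial_cube_radius_le; [lra|]. now rewrite radial_cube_root. }
  assert (HT : forall zeta, Cmod zeta <= r ^ 3 -> Cmod (T zeta) < r ^ 3).
  { intros zeta Hz. unfold T. eapply Rle_lt_trans; [apply Hle|].
    eapply Rle_lt_trans; [apply Cmod_sub_triangle|].
    specialize (Huc zeta Hz). set (z := radial_root zeta) in *.
    assert (HSz : Cmod (S z) <= K * (r ^ 4 / (1 - r))); [|lra].
    specialize (HSb z ltac:(unfold disk; lra)).
    replace (K * (r ^ 4 / (1 - r))) with (K * r ^ 4 / (1 - r)) by (field; lra).
    apply (Rle_div_r _ _ (1 - r)); [lra|].
    apply Rle_trans with (Cmod (S z) * (1 - Cmod z)).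
    - apply Rmult_le_compat_l; [apply Cmod_ge_0|lra].
    - eapply Rle_trans; [exact HSb|]. apply Rmult_le_compat_l; auto.
      apply pow_incr. split; [apply Cmod_ge_0|auto]. }
  destruct (ball_fixed_point T (r ^ 3) (K * (2 * r - r ^ 2) / (1 - r) ^ 2))
    as [zeta [Hz Hfix]].
  - apply pow_le; lra.
  - apply (Rlt_div_l _ 1); lra.
  - intros z Hz. apply Rlt_le; auto.
  - intros x y Hx Hy. unfold T.
    assert (E : (real_linear_inv a b (w - S (radial_root x))
        - real_linear_inv a b (w - S (radial_root y)))%C
       = real_linear_inv a b (S (radial_root y) - S (radial_root x))).
    { unfold real_linear_inv. rewrite !Cminus_conj. unfold Cdiv. ring. }
    rewrite E. eapply Rle_trans; [apply Hle|]. rewrite Cmod_minus_sym.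
    assert (H : Cmod (S (radial_root x) - S (radial_root y)) * (1 - r) ^ 2
      <= K * (2 * r - r ^ 2) * Cmod (radial_cube (radial_root x) - radial_cube (radial_root y)))
      by exact (HS _ _ r Hr (Huc x Hx) (Huc y Hy)).
    rewrite !radial_cube_root in H.
    replace (K * (2 * r - r ^ 2) / (1 - r) ^ 2 * Cmod (x - y))
      with (K * (2 * r - r ^ 2) * Cmod (x - y) / (1 - r) ^ 2) by (field; lra).
    apply (Rle_div_r _ _ _ Hr2). exact H.
  - exists (radial_root zeta). split.
    + apply radial_cube_radius_lt; [lra|]. rewrite radial_cube_root, <- Hfix. auto.
    + assert (E : real_linear a b zeta = (w - S (radial_root zeta))%C).
      { rewrite <- Hfix at 1. unfold T. now apply real_linear_inv_r. }
      unfold S in E. rewrite radial_cube_root in E.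
      replace (F g (radial_root zeta)) 
        with (real_linear a b zeta + (F g (radial_root zeta) - real_linear a b zeta))%C
        by ring.
      rewrite E at 1. ring.
Qed.

Lemma r3_pos (M : R) : 1 <= M -> 0 < r3 M <= 1.
Proof.
  intro HM.
  assert (HK : 0 <= M - 1 / M) by now apply minus_inv_ge_0.
  unfold r3. set (K := M - 1 / M) in *.
  pose proof (sqrt_pos (K + 4 * K ^ 2)).
  split; [apply Rdiv_lt_0_compat; lra|]. apply Rle_div_l; lra.
Qed.

(** [r3 M] is the smaller root of
    [(1 - r)^2 - K (4 r - 3 r^2) = 1 - 2 (1 + 2 K) r + (1 + 3 K) r^2], with
    [K = M - 1 / M], so [K (4 r - 3 r^2) <= (1 - r)^2] up to it.  The claim has
    [2 K r (1 - r)] to spare, hence is strict, also at [r = r3 M]; for [K r = 0] it is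
    clear. *)
Lemma contraction_below_r3 (M r : R) : 1 <= M -> 0 <= r <= r3 M -> r < 1 ->
  (M - 1 / M) * (2 * r - r ^ 2) < (1 - r) ^ 2.
Proof.
  intros HM Hr Hr1.
  assert (HK : 0 <= M - 1 / M) by now apply minus_inv_ge_0.
  destruct Hr as [Hr0 Hr]. unfold r3 in Hr. set (K := M - 1 / M) in *.
  set (s := sqrt (K + 4 * K ^ 2)) in *.
  assert (Hs0 : 0 <= s) by apply sqrt_pos.
  assert (Hs : s * s = K + 4 * K ^ 2) by (apply sqrt_sqrt; nra).
  apply (Rle_div_r _ _ (1 + 2 * K + s)) in Hr; [|lra].
  assert (Hfac : K * (4 * r - 3 * r ^ 2) <= (1 - r) ^ 2).
  { assert (0 <= (1 - r * (1 + 2 * K + s)) * (1 - r * (1 + 2 * K) + r * s)).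
    { apply Rmult_le_pos; [lra|]. nra. }
    assert ((1 - r * (1 + 2 * K + s)) * (1 - r * (1 + 2 * K) + r * s)
      = (1 - r) ^ 2 - K * (4 * r - 3 * r ^ 2)); [|lra].
    replace ((1 - r * (1 + 2 * K + s)) * (1 - r * (1 + 2 * K) + r * s))
      with ((1 - r * (1 + 2 * K)) ^ 2 - r ^ 2 * (s * s)) by ring.
    rewrite Hs. ring. }
  assert (0 < (1 - r) ^ 2) by (apply pow_lt; lra).
  destruct (Req_dec (K * r) 0) as [E|E].
  - nra.
  - assert (0 < K * r) by (pose proof (Rmult_le_pos K r HK Hr0); lra).
    assert (0 < K * r * (1 - r)) by (apply Rmult_lt_0_compat; lra). nra.
Qed.

(** * Sharpness for M = 1 *)

Lemma Derive_n_const_2 (c x : R) : Derive_n (fun _ => c) 2 x = 0.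
Proof.
  simpl. rewrite (Derive_ext _ (fun _ => 0)) by (intro; apply Derive_const).
  apply Derive_const.
Qed.

Lemma Derive_n_id_2 (x : R) : Derive_n (fun t => t) 2 x = 0.
Proof.
  simpl. rewrite (Derive_ext _ (fun _ => 1)) by (intro; apply Derive_id).
  apply Derive_const.
Qed.

Lemma ex_diff_n_const (c : R) (n : nat) (x y : R) : ex_diff_n (fun _ _ => c) n x y.
Proof.
  revert c. induction n as [|n IH]; intro c; (split; [apply continuity_2d_pt_const|]); auto.
  split; [apply ex_derive_const|split; [apply ex_derive_const|]].
  split; (eapply ex_diff_n_ext_loc; [|apply (IH 0)]);
    apply locally_2d_forall; intros u v; symmetry; apply Derive_const.
Qed.

Lemma coordinates_real_harmonic (D : C -> Prop) :
  real_harmonic_on D (fun x _ => x) /\ real_harmonic_on D (fun _ y => y).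
Proof.
  split; intros x y _; split.
  - split; [apply continuity_2d_pt_id1|].
    split; [apply ex_derive_id|split; [apply ex_derive_const|]].
    split; (eapply ex_diff_n_ext_loc; [|apply ex_diff_n_const]);
      apply locally_2d_forall; intros u v; symmetry; [apply Derive_id|apply Derive_const].
  - change (Derive_n (fun t => t) 2 x + Derive_n (fun _ => x) 2 y = 0).
    rewrite Derive_n_const_2, Derive_n_id_2. ring.
  - split; [apply continuity_2d_pt_id2|].
    split; [apply ex_derive_const|split; [apply ex_derive_id|]].
    split; (eapply ex_diff_n_ext_loc; [|apply ex_diff_n_const]);
      apply locally_2d_forall; intros u v; symmetry; [apply Derive_const|apply Derive_id].
  - change (Derive_n (fun _ => y) 2 x + Derive_n (fun t => t) 2 y = 0).
    rewrite Derive_n_const_2, Derive_n_id_2. ring.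
Qed.

Lemma id_admissible : admissible 1 (fun z => z).
Proof.
  split.
  - exact (coordinates_real_harmonic (disk 1)).
  - exists (fun z => z), (fun _ => RtoC 0).
    assert (Hdec : forall z : C, disk 1 z -> z = (z + Cconj 0)%C)
      by (intros z _; apply injective_projections; simpl; ring).
    repeat split; auto.
    + intros z _. exists (RtoC 1). split; [apply is_linear_scal_l|].
      intros x _ eps. exists eps. intros y _.
      change (Cmod ((y + - x) + - ((y + - x) * 1))%C <= eps * Cmod (y - x)).
      replace ((y + - x) + - ((y + - x) * 1))%C with (RtoC 0) by ring.
      rewrite Cmod_0. apply Rmult_le_pos; [apply Rlt_le, cond_pos|apply Cmod_ge_0].
    + intros z _. apply ex_derive_const.
    + rewrite (lambda_at_0 (fun z => z) (fun z => z) (fun _ => RtoC 0) 1 0 Hdec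
        (cderiv_id _) (cderiv_const _ _)).
      rewrite Cmod_1, Cmod_0, Rminus_0_r, Rabs_R1. ring.
    + intros z Hz. rewrite Cmod_0. unfold disk in Hz. lra.
Qed.

Lemma r3_1 : r3 1 = 1.
Proof.
  unfold r3. replace (1 - 1 / 1 + 4 * (1 - 1 / 1) ^ 2) with 0 by field.
  rewrite sqrt_0. field.
Qed.

Lemma sigma3_1 : sigma3 1 = 1.
Proof. unfold sigma3. destruct (Rlt_dec 1 1); [lra|reflexivity]. Qed.

Theorem theorem2 :
  (forall (M : R) (g : C -> C), admissible M g ->
     univalent_on (disk 1) (F g) (disk (r3 M)) /\
     image_contains (F g) (disk (r3 M)) (disk (sigma3 M)))
  /\
  (r3 1 = 1 /\ sigma3 1 = 1 /\
   (forall r : R, r3 1 < r ->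
      ~ (forall g : C -> C, admissible 1 g ->
           univalent_on (disk 1) (F g) (disk r))) /\
   (forall s : R, sigma3 1 < s ->
      ~ (forall g : C -> C, admissible 1 g ->
           image_contains (F g) (disk (r3 1)) (disk s)))).
Proof.
  split; [|split; [exact r3_1|split; [exact sigma3_1|split]]].
  - intros M g Hg.
    pose proof (proj1 (admissible_decomposition M g Hg)) as HM.
    pose proof (r3_pos M HM) as Hr3.
    split; [split|].
    + unfold disk. intros z Hz. lra.
    + unfold disk. intros z w Hz Hw HF.
      assert (Hmax : Rmax (Cmod z) (Cmod w) < r3 M) by (apply Rmax_lub_lt; auto).
      pose proof (Rmax_l (Cmod z) (Cmod w)) as H1. pose proof (Rmax_r (Cmod z) (Cmod w)) as H2.
      pose proof (Cmod_ge_0 z).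
      apply (F_injective M (Rmax (Cmod z) (Cmod w)) g z w Hg); auto; [lra|].
      apply contraction_below_r3; lra.
    + intros w Hw. unfold disk in *. unfold sigma3 in Hw.
      destruct (Rlt_dec 1 M) as [HM1|HM1].
      * assert (Hlt : r3 M < 1).
        { assert (HK : 0 < M - 1 / M).
          { assert (/ M < 1) by (rewrite <- Rinv_1; apply Rinv_lt_contravar; lra). lra. }
          unfold r3. apply Rlt_div_l; pose proof (sqrt_pos (M - 1 / M + 4 * (M - 1 / M) ^ 2));
            lra. }
        apply (F_covers M (r3 M) g w Hg); [lra| |exact Hw].
        apply contraction_below_r3; lra.
      * assert (E : M = 1) by lra. subst M. rewrite r3_1.
        pose proof (Cmod_ge_0 w).
        (* Here r3 = 1 is excluded as a radius, so r < 1 with r^3 > |w| is taken: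
           (1 - e/4)^3 > 1 - e. *)
        set (e := 1 - Cmod w) in *. set (r := 1 - e / 4).
        destruct (F_covers 1 r g w Hg) as [z [Hz HF]].
        -- unfold r, e. lra.
        -- apply contraction_below_r3; rewrite ?r3_1; unfold r, e; lra.
        -- replace (1 - 1 / 1) with 0 by field. rewrite Rmult_0_l, Rminus_0_r.
           replace (Cmod w) with (1 - e) by (unfold e; ring). unfold r.
           assert (0 < e <= 1) by (unfold e; lra). nra.
        -- exists z. split; auto. unfold r, e in Hz. lra.
  - intros r Hr H. rewrite r3_1 in Hr. destruct (H _ id_admissible) as [Hsub _].
    specialize (Hsub 1). unfold disk in Hsub. rewrite Cmod_1 in Hsub. specialize (Hsub Hr). lra.
  - intros s Hs H. rewrite sigma3_1 in Hs.
    destruct (H _ id_admissible 1) as [z [Hz HF]]; [unfold disk; rewrite Cmod_1; lra|].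
    unfold disk in Hz. rewrite r3_1 in Hz. apply (f_equal Cmod) in HF.
    change (F (fun z => z) z) with (radial_cube z) in HF. rewrite Cmod_radial_cube, Cmod_1 in HF.
    pose proof (Cmod_ge_0 z). assert (Cmod z ^ 3 < 1 ^ 3); [|lra].
    apply Rnot_le_lt. intro. nra.
Qed.
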